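(* Let $(\mathcal{E},\mathcal{F})$ be a regular Dirichlet form in $L^{2}(M,\mu)$. If conditions $(\mathrm{VD})$, $(\mathrm{Cap}_{\le})$, $(\mathrm{FK})$ and $(\mathrm{wEH})$ (defined in the context) hold, then conditions $(\mathrm{E}_{\ge})$ and $(\mathrm{E}_{\le})$ (defined in the context) hold.
   Context: Metric measure space: $(M,d)$ is a locally compact separable metric space, $\mu$ a Radon measure on $M$ with full support, $B(x,r)=\{y\in M:d(x,y)<r\}$, $V(x,r)=\mu(B(x,r))$. Every ball is assumed precompact and comes with a fixed centre and radius; for $B=B(x,r)$ and $\lambda>0$, $\lambda B=B(x,\lambda r)$. $\overline R\in(0,\mathrm{diam}(M)]$ is fixed (possibly $\infty$). The map $w:M\times[0,\infty)\to[0,\infty)$ is such that $w(x,\cdot)$ is continuous, strictly increasing, $w(x,0)=0$ for each $x$, and there are constants $C_1,C_2>0$, $\beta_2\ge\beta_1>0$ with $C_1(R/r)^{\beta_1}\le w(x,R)/w(y,r)\le C_2(R/r)^{\beta_2}$ for all $0<r\le R<\infty$ and $x,y\in M$ with $d(x,y)\le R$. For $B=B(x,R)$ write $w(B)=w(x,R)$. Ess inf, ess sup are with respect to $\mu$. Dirichlet form: the form has no killing part, i.e. $\mathcal E=\mathcal E^{(L)}+\mathcal E^{(J)}$ with $\mathcal E^{(L)}$ strongly local and $\mathcal E^{(J)}(u,u)=\iint_{M\times M\setminus\mathrm{diag}}(u(x)-u(y))^2J(dx,dy)$, and the (symmetric) jump measure is given by a transition kernel, $J(dx,dy)=J(x,dy)\mu(dx)$.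 $\mathcal F'=\{v+a:v\in\mathcal F,a\in\mathbb R\}$, $\mathcal E(u+a,v+b):=\mathcal E(u,v)$ for $u,v\in\mathcal F$, $a,b\in\mathbb R$. For open $\Omega\subset M$, $\mathcal F(\Omega)$ is the closure of $\mathcal F\cap C_0(\Omega)$ in the norm $\sqrt{\mathcal E(u,u)+\|u\|_2^2}$, $C_0(\Omega)$ being the continuous functions with compact support in $\Omega$. For open $U\Subset V$ ($U$ precompact, $\overline U\subset V$), $\mathrm{cutoff}(U,V)$ is the set of $\phi\in\mathcal F$ with $\phi=1$ on $U$, $\phi=0$ on $V^c$, $0\le\phi\le1$; and $\mathrm{cap}(U,V)=\inf\{\mathcal E(\varphi,\varphi):\varphi\in\mathrm{cutoff}(U,V)\}$. A function $u\in\mathcal F'$ is $f$-superharmonic in $\Omega$ if $\mathcal E(u,\varphi)\ge(f,\varphi)$ for all $0\le\varphi\in\mathcal F(\Omega)$. $T_{U,\Omega}(v)=\operatorname{ess\,sup}_{x\in U}\int_{\Omega^c}|v(y)|J(x,dy)$ for open $U\Subset\Omega$; $u_-=\max(0,-u)$. $(\mathrm{VD})$: there is $C_\mu\ge1$ with $V(x,2r)\le C_\mu V(x,r)$ for all $x\in M$, $r>0$. $(\mathrm{Cap}_\le)$: there is $C>0$ with $\mathrm{cap}((2/3)B,B)\le C\mu(B)/w(B)$ for all balls $B$ of radius less than $\overline R$. $(\mathrm{FK})$: there are $C_F,\nu>0$, $\sigma\in(0,1)$ such that for every ball $B=B(x,r)$ with $0<r<\sigma\overline R$ and every non-empty open $D\subset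 B$, $\lambda_1(D)\ge\frac{C_F^{-1}}{w(B)}\big(\frac{\mu(B)}{\mu(D)}\big)^\nu$, where $\lambda_1(D)=\inf_{u\in\mathcal F(D)\setminus\{0\}}\mathcal E(u,u)/\|u\|_2^2$. $(\mathrm{wEH})$: there exist $p,\delta,\sigma\in(0,1)$, $C_H\ge1$ such that for all concentric balls $B_r=B(x_0,r)\subset B_R=B(x_0,R)$ with $0<r\le\delta R$, $R<\sigma\overline R$, every $f\in L^\infty(B_R)$ and every $u\in\mathcal F'\cap L^\infty$ non-negative and $f$-superharmonic in $B_R$, $\big(\frac1{\mu(B_r)}\int_{B_r}u^pd\mu\big)^{1/p}\le C_H\big(\operatorname{ess\,inf}_{B_r}u+w(B_r)(T_{\frac34B_R,B_R}(u_-)+\|f\|_{L^\infty(B_R)})\big)$. For a ball $B$, $E^B\in\mathcal F(B)$ denotes the weak solution of $-\mathcal L^Bu=1$ in $B$ ($\mathcal L^B$ the generator of $(\mathcal E,\mathcal F(B))$), i.e. $\mathcal E(E^B,\varphi)=(1,\varphi)$ for all $0\le\varphi\in\mathcal F(B)$. $(\mathrm E_\ge)$: there are $C>0$ and $\sigma,\delta\in(0,1)$ such that $\operatorname{ess\,inf}_{\delta B}E^B\ge Cw(B)$ for all balls $B$ of radius less than $\sigma\overline R$. $(\mathrm E_\le)$: there are $C>0$ and $\sigma\in(0,1)$ such that $\|E^B\|_{L^\infty}\le Cw(B)$ for all balls $B$ of radius less than $\sigma\overline R$. *)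

(* Defs.v *)
From HB Require Import structures.
From mathcomp Require Import all_boot all_order all_algebra.
From mathcomp Require Import all_classical all_reals all_analysis.
From mathcomp Require Import ess_sup_inf.

Set Implicit Arguments.
Unset Strict Implicit.
Unset Printing Implicit Defensive.

Import Order.TTheory GRing.Theory Num.Theory.
Import numFieldNormedType.Exports.

Local Open Scope classical_set_scope.
Local Open Scope ring_scope.

(* The sigma-algebra is a separate structure on the carrier; [borel] below ties
   it to the metric topology. *)
#[short(type="metricMeasurableType")]
HB.structure Definition MetricMeasurable (d : measure_display)
    (K : numDomainType) :=
  { M of Metric K M & Measurable d M }.

Section ess_bounds_on_a_set.
Context {d : measure_display} {T : measurableType d} {R : realType}.
Variable mu : {measure set T -> \bar R}.
Implicit Types (D : set T) (f : T -> \bar R).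

Definition ess_inf_on D f : \bar R := ess_inf mu (patch (cst +oo%E) D f).
Definition ess_sup_on D f : \bar R := ess_sup mu (patch (cst -oo%E) D f).

End ess_bounds_on_a_set.

Section metric_measure_space.
Context {d : measure_display} {R : realType} {M : metricMeasurableType d R}.
Implicit Types (mu : {measure set M -> \bar R}) (Rbar : \bar R).

Definition borel : Prop := @measurable d M = <<s @open M >>.

Definition separable_space (T : topologicalType) : Prop :=
  exists2 D : set T, countable D & dense D.

(* [m] is a Radon measure on the subspace [D] of [X]. *)
Definition radon_on (X : topologicalType) (S : set (set X)) (D : set X)
    (m : set X -> \bar R) : Prop :=
  (forall K, compact K -> K `<=` D -> (m K < +oo)%E) /\
  (forall A, S A -> A `<=` D ->
     m A = ereal_sup [set m K | K in [set K | compact K /\ K `<=` A]]).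

Definition full_support mu : Prop :=
  forall U : set M, open U -> U !=set0 -> (0 < mu U)%E.

Definition metric_measure_space mu : Prop :=
  [/\ borel, locally_compact [set: M], separable_space M,
      radon_on (@measurable d M) [set: M] mu & full_support mu].

Definition balls_precompact : Prop :=
  forall (x : M) (r : R), 0 < r -> precompact (ball x r).

Definition diam : \bar R :=
  ereal_sup [set (mdist z.1 z.2)%:E | z in [set: M * M]].

Definition admissible_radius Rbar : Prop := (0 < Rbar <= diam)%E.

Definition scale_function (w : M -> R -> R) : Prop :=
  [/\ forall x, {within `[0, +oo[, continuous (w x)},
      forall x, {in `[0, +oo[ &, {homo w x : r s / r < s}},
      forall x, w x 0 = 0 &
      exists C1 C2 beta1 beta2 : R,
        [/\ 0 < C1, 0 < C2, 0 < beta1, beta1 <= beta2 &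
            forall (x y : M) (r s : R), 0 < r -> r <= s -> mdist x y <= s ->
              C1 * (s / r) `^ beta1 <= w x s / w y r <= C2 * (s / r) `^ beta2]].

End metric_measure_space.

Section dirichlet_forms.
Context {d : measure_display} {R : realType} {M : metricMeasurableType d R}.
Variable mu : {measure set M -> \bar R}.
Implicit Types (F : set (M -> R)) (E : (M -> R) -> (M -> R) -> R).
Implicit Types (u v : M -> R) (U V Omega : set M).

(* Elements of L^2 are represented by Borel functions; [symmetric_nonneg_form]
   and [dirichlet_form] below only see their mu-a.e. classes. *)
Definition L2 : set (M -> R) := [set u | u \in Lfun mu 2%:E].
Definition Linfty : set (M -> R) := [set u | u \in Lfun mu +oo%E].

(* Meant for u in L^2, where the integral is finite. *)
Definition sqnorm2 u : R := \int[mu]_x (u x ^+ 2).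

(* C_0(Omega): continuous functions with compact support in Omega. *)
Definition C0 Omega : set (M -> R) :=
  [set u | [/\ continuous u, compact (closure [set x | u x != 0]) &
               closure [set x | u x != 0] `<=` Omega]].

(* The support of the measure |u| dmu. *)
Definition ae_support u : set M :=
  [set x | forall U, open U -> U x -> ~ (u = cst 0 %[ae mu in U])].

Definition symmetric_nonneg_form F E : Prop :=
  [/\ forall u v, F u -> F v -> E u v = E v u,
      forall (a : R) u v phi, F u -> F v -> F phi ->
        E (a *: u + v) phi = a * E u phi + E v phi,
      forall u, F u -> 0 <= E u u &
      forall u v phi, F u -> F v -> F phi -> u = v %[ae mu] ->
        E u phi = E v phi].

Definition E1 E u : R := E u u + sqnorm2 u.

Definition closed_form F E : Prop :=
  forall u_ : nat -> M -> R, (forall n, F (u_ n)) ->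
    (forall e : R, 0 < e -> exists N, forall m n, (N <= m)%N -> (N <= n)%N ->
       E1 E (u_ m - u_ n) < e) ->
    exists2 u, F u & E1 E (u_ n - u) @[n --> \oo] --> 0.

Definition markovian F E : Prop :=
  forall u, F u ->
    let v := fun x => Num.min (Num.max (u x) 0) 1 in
    F v /\ E v v <= E u u.

Definition dirichlet_form F E : Prop :=
  [/\ F `<=` L2 /\
      (forall u v, F u -> L2 v -> u = v %[ae mu] -> F v),
      F 0 /\ (forall (a : R) u v, F u -> F v -> F (a *: u + v)),
      forall u (e : R), L2 u -> 0 < e -> exists2 v, F v & sqnorm2 (u - v) < e,
      symmetric_nonneg_form F E &
      closed_form F E /\ markovian F E].

Definition regular_form F E : Prop :=
  (forall u (e : R), F u -> 0 < e ->
     exists2 v, (F `&` C0 setT) v & E1 E (u - v) < e) /\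
  (forall u (e : R), C0 setT u -> 0 < e ->
     exists2 v, (F `&` C0 setT) v & forall x, `|u x - v x| < e).

Definition strongly_local F E : Prop :=
  forall u v, F u -> F v ->
    compact (ae_support u) -> compact (ae_support v) ->
    (exists U (a : R),
       [/\ open U, ae_support v `<=` U & u = cst a %[ae mu in U]]) ->
    E u v = 0.

Definition offdiag : set (M * M) := [set z | z.1 <> z.2].

(* [j] is the jump measure on the complement of the diagonal; its values on sets
   meeting the diagonal are irrelevant. *)
Definition jump_measure (j : {measure set (M * M) -> \bar R})
    (J : R.-ker M ~> M) : Prop :=
  [/\ @radon_on R (M * M)%type (@measurable _ (M * M)%type) offdiag j,
      forall A, measurable A -> A `<=` offdiag ->
        j [set z | A (z.2, z.1)] = j A &
      forall A, measurable A -> A `<=` offdiag ->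
        j A = (\int[mu]_x J x (xsection A x))%E].

(* Beurling-Deny decomposition without killing part and with jump kernel [J]. *)
Definition no_killing_part F E (J : R.-ker M ~> M) : Prop :=
  exists (EL EJ : (M -> R) -> (M -> R) -> R)
         (j : {measure set (M * M) -> \bar R}),
    [/\ forall u v, F u -> F v -> E u v = EL u v + EJ u v,
        symmetric_nonneg_form F EL /\ symmetric_nonneg_form F EJ,
        strongly_local F EL,
        jump_measure j J &
        forall u, F u ->
          (EJ u u)%:E = (\int[j]_(z in offdiag) ((u z.1 - u z.2) ^+ 2)%:E)%E].

(* F(Omega) *)
Definition dom_on F E Omega : set (M -> R) :=
  [set u | F u /\ forall e : R, 0 < e ->
     exists2 v, (F `&` C0 Omega) v & E1 E (u - v) < e].

Definition cutoff F U V : set (M -> R) :=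
  [set phi | [/\ F phi, phi = cst 1 %[ae mu in U],
                 phi = cst 0 %[ae mu in ~` V] &
                 \forall x \ae mu, 0 <= phi x <= 1]].

Definition cap F E U V : \bar R :=
  ereal_inf [set (E phi phi)%:E | phi in cutoff F U V].

Definition lambda1 F E Omega : \bar R :=
  ereal_inf [set (E u u / sqnorm2 u)%:E |
    u in [set u | dom_on F E Omega u /\ ~ (u = cst 0 %[ae mu])]].

(* F' = F + constants; as E(u + a, phi) = E(u, phi), superharmonicity of an
   element u = v + a of F' is expressed through v. *)
Definition Fprime F : set (M -> R) :=
  [set u | exists2 v, F v & exists a : R, u = v + cst a].

Definition superharmonic F E Omega (f : M -> R) u : Prop :=
  exists2 v, F v & exists2 a : R, u = v + cst a &
    forall phi, dom_on F E Omega phi -> (\forall x \ae mu, 0 <= phi x) ->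
      (\int[mu]_(x in Omega) (f x * phi x)%:E <= (E v phi)%:E)%E.

(* T_{U, Omega}(u) *)
Definition tail (J : R.-ker M ~> M) U Omega u : \bar R :=
  ess_sup_on mu U (fun x => \int[J x]_(y in ~` Omega) `|u y|%:E)%E.

(* - L^Omega u = 1 in Omega, L^Omega the generator of (E, F(Omega)). *)
Definition weak_solution F E Omega u : Prop :=
  dom_on F E Omega u /\
  forall phi, dom_on F E Omega phi -> (\forall x \ae mu, 0 <= phi x) ->
    (E u phi)%:E = (\int[mu]_x (phi x)%:E)%E.

(* u represents the a.e. class of the function E^Omega. *)
Definition the_weak_solution F E Omega u : Prop :=
  weak_solution F E Omega u /\
  forall v, weak_solution F E Omega v -> v = u %[ae mu].

End dirichlet_forms.

Section conditions.
Context {d : measure_display} {R : realType} {M : metricMeasurableType d R}.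
Variable mu : {measure set M -> \bar R}.
Variables (F : set (M -> R)) (E : (M -> R) -> (M -> R) -> R).
Variables (J : R.-ker M ~> M) (w : M -> R -> R) (Rbar : \bar R).

Definition VD : Prop :=
  exists2 C : R, 1 <= C &
    forall (x : M) (r : R), 0 < r -> (mu (ball x (2 * r)) <= C%:E * mu (ball x r))%E.

Definition Cap_le : Prop :=
  exists2 C : R, 0 < C &
    forall (x : M) (r : R), 0 < r -> (r%:E < Rbar)%E ->
      (cap mu F E (ball x (2 / 3 * r)) (ball x r)
         <= (C / w x r)%:E * mu (ball x r))%E.

Definition FK : Prop :=
  exists CF nu sigma : R, [/\ 0 < CF, 0 < nu, 0 < sigma < 1 &
    forall (x : M) (r : R) (D : set M), 0 < r -> (r%:E < sigma%:E * Rbar)%E ->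
      open D -> D !=set0 -> D `<=` ball x r ->
      ((CF^-1 / w x r * (fine (mu (ball x r)) / fine (mu D)) `^ nu)%:E
         <= lambda1 mu F E D)%E].

Definition wEH : Prop :=
  exists p delta sigma CH : R,
    [/\ 0 < p < 1, 0 < delta < 1, 0 < sigma < 1, 1 <= CH &
    forall (x0 : M) (r s : R) (f u : M -> R),
      0 < r -> r <= delta * s -> (s%:E < sigma%:E * Rbar)%E ->
      Linfty mu (f \_ (ball x0 s)) ->
      Fprime F u -> Linfty mu u ->
      (\forall x \ae mu, ball x0 s x -> 0 <= u x) ->
      superharmonic mu F E (ball x0 s) f u ->
      (((fine (mu (ball x0 r)))^-1%:E *
          \int[mu]_(x in ball x0 r) (u x `^ p)%:E) `^ p^-1
       <= CH%:E * (ess_inf_on mu (ball x0 r) (EFin \o u) +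
            (w x0 r)%:E *
              (tail mu J (ball x0 (3 / 4 * s)) (ball x0 s) (u^\-)%R +
               'N[mu]_+oo[EFin \o (f \_ (ball x0 s))])))%E].

Definition E_ge : Prop :=
  exists C sigma delta : R, [/\ 0 < C, 0 < sigma < 1, 0 < delta < 1 &
    forall (x : M) (r : R), 0 < r -> (r%:E < sigma%:E * Rbar)%E ->
      exists2 u, the_weak_solution mu F E (ball x r) u &
        ((C * w x r)%:E <= ess_inf_on mu (ball x (delta * r)) (EFin \o u))%E].

Definition E_le : Prop :=
  exists C sigma : R, [/\ 0 < C, 0 < sigma < 1 &
    forall (x : M) (r : R), 0 < r -> (r%:E < sigma%:E * Rbar)%E ->
      exists2 u, the_weak_solution mu F E (ball x r) u &
        ('N[mu]_+oo[EFin \o u] <= (C * w x r)%:E)%E].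

End conditions.

(* Main.v *)
Require Import Defs.
From HB Require Import structures.
From mathcomp Require Import all_boot all_order all_algebra.
From mathcomp Require Import all_classical all_reals all_analysis.
From mathcomp Require Import ess_sup_inf measurable_realfun.
From mathcomp Require Import ring lra.

Set Implicit Arguments.
Unset Strict Implicit.
Unset Printing Implicit Defensive.

Import Order.TTheory GRing.Theory Num.Theory.
Import numFieldNormedType.Exports.

Local Open Scope classical_set_scope.
Local Open Scope ring_scope.

(** The function E^B, called the torsion function of B below, is the minimiser
    of v |-> E(v, v) - 2 \int_B v over the Hilbert space F(B).  The Faber-Krahn
    inequality applied to D = B is a Poincare inequality on F(B), with constant
    of order 1 / w(B), so the functional is bounded below and minimising
    sequences are Cauchy by the parallelogram law; this gives existence
    ([torsion_exists]), uniqueness and nonnegativity.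

    The upper bound is De Giorgi's iteration on the level sets of u = E^B
    ([level_decay], [de_giorgi_iteration]).  Testing the equation with
    (u - t)_+ gives E((u - t)_+) <= \int (u - t)_+, and Faber-Krahn on {u > t}
    turns this into a superlinear decay of t |-> mu {u >= t}, which therefore
    vanishes beyond a level of order w(B).  As Faber-Krahn is available on open
    sets only and u need not be continuous, the argument is run on the level
    sets of a continuous element v of F(B) that is close to u.

    For the lower bound, let phi in F(B) be a cutoff function of ball (r / 3) in
    ball (r / 2) with E(phi, phi) <= C mu(B) / w(B), which exists by the capacity
    condition.  Testing the equation with g = (lam phi - u)_+ gives
<<
      \int g = E(u, g) <= lam E(phi, g) - E(g, g) <= lam^2 / 4 * E(phi, phi),
>>
    ([torsion_deficit_le]); since g >= lam / 2 where phi = 1 and u <= lam / 2,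
    the set {u <= lam / 2} fills at most half of a small concentric ball once
    lam is a small multiple of w(B).  Hence the L^p average of u on the small
    ball is at least of order w(B).  As u is nonnegative and superharmonic with
    right-hand side 0, its tail vanishes and the weak Harnack inequality bounds
    ess inf u from below by that average ([E_ge_of_wEH]).

    Every test function above is built from elements of F by lattice operations.
    That F(B) is stable under these operations rests on a weak compactness
    principle ([weak_closure]): a limit in L^2 of an energy-bounded family is a
    limit, for the norm of F, of averages of its members. *)


(** * Square-integrable functions *)

Section square_integrable_functions.
Context {d : measure_display} {R : realType} {M : metricMeasurableType d R}.
Variable mu : {measure set M -> \bar R}.
Implicit Types (u v w f g h : M -> R) (A : set M).

Lemma sqrD_le2 (a b : R) : (a + b) ^+ 2 <= 2 * a ^+ 2 + 2 * b ^+ 2.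
Proof. by have := sqr_ge0 (a - b); nra. Qed.

Lemma sqrB_le2 (a b : R) : (a - b) ^+ 2 <= 2 * a ^+ 2 + 2 * b ^+ 2.
Proof. by have := sqr_ge0 (a + b); nra. Qed.

Lemma superlevel_measurable u (t : R) : measurable_fun setT u ->
  measurable [set x | t <= u x].
Proof.
move=> mf; rewrite -[X in measurable X]setTI.
by have := mf measurableT _ (measurable_itv `[t, +oo[); congr measurable;
  apply/seteqP; split=> x /=; rewrite in_itv/= andbT.
Qed.

Lemma L2P u : L2 mu u <-> measurable_fun setT u /\
  mu.-integrable setT (EFin \o (fun x => u x ^+ 2)).
Proof.
split=> [L2u|[mu_ iu]].
  split; last exact: Lfun2_integrable_sqr.
  by move: L2u; rewrite /L2/= => /sub_Lfun_mfun; rewrite inE.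
apply/andP; split; rewrite inE//= /finite_norm unlock.
apply: poweR_lty; move/integrableP : iu => [_]; apply: le_lt_trans.
rewrite le_eqVlt; apply/orP; left; apply/eqP; apply: eq_integral => x _ /=.
by rewrite powR_mulrn// real_normK ?num_real// ger0_norm ?sqr_ge0.
Qed.

Lemma L2_measurable u : L2 mu u -> measurable_fun setT u.
Proof. by move=> /L2P[]. Qed.

Lemma L2_sqr_integrable u : L2 mu u ->
  mu.-integrable setT (EFin \o (fun x => u x ^+ 2)).
Proof. by move=> /L2P[]. Qed.

Lemma integrable_sqrD a b u v : L2 mu u -> L2 mu v ->
  mu.-integrable setT (EFin \o (fun x => a * u x ^+ 2 + b * v x ^+ 2)).
Proof.
move=> /L2_sqr_integrable iu /L2_sqr_integrable iv.
have -> : (EFin \o (fun x => a * u x ^+ 2 + b * v x ^+ 2)) =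
  (fun x => a%:E * (u x ^+ 2)%:E)%E \+ (fun x => b%:E * (v x ^+ 2)%:E)%E.
  by apply/funext => x /=; rewrite -!EFinM -EFinD.
by apply: integrableD => //; exact: integrableZl.
Qed.

(** Domination is stated for squares: this one form covers sums, multiples,
    midpoints and contractions, at the level of L^2 and of its norm. *)
Lemma L2_dominated a b u v w : L2 mu u -> L2 mu v -> measurable_fun setT w ->
  (forall x, w x ^+ 2 <= a * u x ^+ 2 + b * v x ^+ 2) -> L2 mu w.
Proof.
move=> L2u L2v mw wuv; apply/L2P; split => //.
apply: le_integrable (integrable_sqrD a b L2u L2v) => //.
  by apply/measurable_EFinP; exact: measurable_funX.
move=> x _ /=; rewrite lee_fin ger0_norm ?sqr_ge0//.
exact: le_trans (ler_norm _).
Qed.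

Lemma sqnorm2_ge0 u : 0 <= sqnorm2 mu u.
Proof. by apply: Rintegral_ge0 => x _; exact: sqr_ge0. Qed.

Lemma sqnorm2_dominated a b u v w : L2 mu u -> L2 mu v ->
  measurable_fun setT w ->
  (forall x, w x ^+ 2 <= a * u x ^+ 2 + b * v x ^+ 2) ->
  sqnorm2 mu w <= a * sqnorm2 mu u + b * sqnorm2 mu v.
Proof.
move=> L2u L2v mw wuv; have L2w := L2_dominated L2u L2v mw wuv.
have iu := L2_sqr_integrable L2u; have iv := L2_sqr_integrable L2v.
rewrite /sqnorm2 -RintegralZl// -RintegralZl//.
rewrite -RintegralD//; last 2 first.
- by move: (integrableZl measurableT a iu).
- by move: (integrableZl measurableT b iv).
apply: le_Rintegral => //; first exact: L2_sqr_integrable.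
exact: integrable_sqrD.
Qed.

Lemma L2Z c u : L2 mu u -> L2 mu (c *: u).
Proof.
move=> L2u; apply: (L2_dominated (a := c ^+ 2) (b := 0) L2u L2u).
  apply: measurable_funM => //; exact: L2_measurable.
by move=> x; rewrite /= mul0r addr0 -exprMn.
Qed.

Lemma L2B u v : L2 mu u -> L2 mu v -> L2 mu (u - v).
Proof.
move=> L2u L2v; apply: (L2_dominated (a := 2) (b := 2) L2u L2v).
  by apply: measurable_funB; exact: L2_measurable.
by move=> x; exact: sqrB_le2.
Qed.

Lemma sqnorm2D u v : L2 mu u -> L2 mu v ->
  sqnorm2 mu (u + v) <= 2 * sqnorm2 mu u + 2 * sqnorm2 mu v.
Proof.
move=> L2u L2v; apply: sqnorm2_dominated => //.
  by apply: measurable_funD; exact: L2_measurable.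
by move=> x; exact: sqrD_le2.
Qed.

Lemma sqnorm2B u v w : L2 mu u -> L2 mu v -> L2 mu w ->
  sqnorm2 mu (u - w) <= 2 * sqnorm2 mu (u - v) + 2 * sqnorm2 mu (v - w).
Proof.
move=> L2u L2v L2w.
have -> : u - w = (u - v) + (v - w) by rewrite addrA subrK.
by apply: sqnorm2D; exact: L2B.
Qed.

Lemma sqnorm2_le u v : L2 mu v -> measurable_fun setT u ->
  (forall x, `|u x| <= `|v x|) -> sqnorm2 mu u <= sqnorm2 mu v.
Proof.
move=> L2v mu_ uv.
rewrite -[leRHS]mul1r -[leRHS]addr0 -(mul0r (sqnorm2 mu v)).
apply: sqnorm2_dominated => // x.
rewrite mul0r addr0 mul1r -(real_normK (num_real (u x))).
by rewrite -(real_normK (num_real (v x))) lerXn2r// nnegrE.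
Qed.

Lemma L2_le u v : L2 mu v -> measurable_fun setT u ->
  (forall x, `|u x| <= `|v x|) -> L2 mu u.
Proof.
move=> L2v mu_ uv; apply: (L2_dominated (a := 1) (b := 0) L2v L2v) => // x.
rewrite mul0r addr0 mul1r -(real_normK (num_real (u x))).
by rewrite -(real_normK (num_real (v x))) lerXn2r// nnegrE.
Qed.

Lemma sqnorm2_ae u v : measurable_fun setT u -> measurable_fun setT v ->
  u = v %[ae mu] -> sqnorm2 mu u = sqnorm2 mu v.
Proof.
move=> mu_ mv uv; congr fine; apply: ae_eq_integral => //.
- by apply/measurable_EFinP; exact: measurable_funX.
- by apply/measurable_EFinP; exact: measurable_funX.
- by apply: filterS uv => x uv Dx; rewrite uv.
Qed.

Lemma sqnorm2_EFin u : L2 mu u ->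
  (sqnorm2 mu u)%:E = (\int[mu]_x (u x ^+ 2)%:E)%E.
Proof.
move=> /L2_sqr_integrable iu; rewrite fineK//.
exact: integrable_fin_num.
Qed.

Lemma sqnorm2_eq0 u : L2 mu u -> sqnorm2 mu u <= 0 -> u = cst 0 %[ae mu].
Proof.
move=> L2u u0; have /integrableP[m2 _] := L2_sqr_integrable L2u.
have [|N [mN N0 sN]] := (ae_eq_integral_abs mu measurableT m2).1.
  transitivity (\int[mu]_x (u x ^+ 2)%:E)%E.
    by apply: eq_integral => x _ /=; rewrite ger0_norm ?sqr_ge0.
  by rewrite -sqnorm2_EFin//; apply/eqP; rewrite eqe eq_le u0 sqnorm2_ge0.
exists N; split=> // x /= ux; apply: sN => /= ux2; apply: ux => _.
by have /eqP := ux2 I; rewrite /= eqe sqrf_eq0 => /eqP.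
Qed.

Lemma sqnorm2_chebyshev u A c : L2 mu u -> measurable A -> 0 <= c ->
  (forall x, A x -> c <= `|u x|) ->
  ((c ^+ 2)%:E * mu A <= (sqnorm2 mu u)%:E)%E.
Proof.
move=> L2u mA c0 cu; have /integrableP[m2 _] := L2_sqr_integrable L2u.
rewrite sqnorm2_EFin// -integral_cst//.
apply: (@le_trans _ _ (\int[mu]_(x in A) (u x ^+ 2)%:E)%E).
  apply: ge0_le_integral => //.
  - by move=> x _ /=; rewrite lee_fin sqr_ge0.
  - exact: measurable_funTS.
  - move=> x Ax; rewrite /= lee_fin -[leRHS]real_normK ?num_real//.
    by rewrite lerXn2r ?nnegrE ?cu.
apply: ge0_subset_integral => //.
by move=> x _; rewrite lee_fin sqr_ge0.
Qed.

Lemma L2_integrable_on u A : L2 mu u -> measurable A -> (mu A < +oo)%E ->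
  mu.-integrable A (EFin \o u).
Proof.
move=> L2u mA muA; have L2sq := L2_sqr_integrable L2u.
have i1 : mu.-integrable A (EFin \o cst 1).
  apply/integrableP; split; first exact/measurable_EFinP.
  under eq_integral do rewrite /= normr1.
  by rewrite integral_cst// mul1e.
have i2 : mu.-integrable A (EFin \o (fun x => u x ^+ 2)).
  exact: integrableS L2sq.
apply: le_integrable (integrableD mA i1 i2) => //.
  apply/measurable_EFinP; apply: measurable_funTS; exact: L2_measurable.
move=> x _ /=; rewrite lee_fin.
rewrite [leRHS]ger0_norm ?addr_ge0 ?sqr_ge0//.
rewrite -(real_normK (num_real (u x))).
by have := sqr_ge0 (`|u x| - 1); nra.
Qed.

(** Integrated form of 2 u <= a u^2 + 1 / a; it replaces the Cauchy-Schwarz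
    inequality, the weight a being tuned to the Poincare constant at hand. *)
Lemma Rintegral_le_sqnorm2 u A a : L2 mu u -> measurable A ->
  (mu A < +oo)%E -> 0 < a ->
  \int[mu]_(x in A) u x <= a / 2 * sqnorm2 mu u + (2 * a)^-1 * fine (mu A).
Proof.
move=> L2u mA muA a0; have L2sq := L2_sqr_integrable L2u.
have i1 : mu.-integrable A (EFin \o cst (2 * a)^-1).
  apply/integrableP; split; first exact/measurable_EFinP.
  under eq_integral do rewrite /=.
  by rewrite integral_cst// lte_mul_pinfty// ?lee_fin.
have i2 : mu.-integrable A (EFin \o (fun x => a / 2 * u x ^+ 2)).
  by move: (integrableS measurableT mA (@subsetT _ _)
    (integrableZl measurableT (a / 2) L2sq)).
have sA : \int[mu]_(x in A) (u x ^+ 2) <= sqnorm2 mu u.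
  rewrite -lee_fin sqnorm2_EFin// fineK; last first.
    by apply: integrable_fin_num => //; exact: integrableS L2sq.
  apply: ge0_subset_integral => //; first exact: measurable_int L2sq.
  by move=> x _; rewrite lee_fin sqr_ge0.
rewrite -Rintegral_cst//.
apply: (@le_trans _ _ (\int[mu]_(x in A) (a / 2 * u x ^+ 2 + (2 * a)^-1))).
  apply: le_Rintegral => //; first exact: L2_integrable_on.
    by move: (integrableD mA i2 i1).
  move=> x _; rewrite -subr_ge0.
  have -> : a / 2 * u x ^+ 2 + (2 * a)^-1 - u x = (a * u x - 1) ^+ 2 / (2 * a).
    by field; rewrite gt_eqF.
  by rewrite divr_ge0 ?sqr_ge0// mulr_ge0// ltW.
rewrite RintegralD// lerD2r RintegralZl//; last exact: integrableS L2sq.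
by rewrite ler_wpM2l// divr_ge0// ltW.
Qed.

(** The part of u outside A is pointwise below u - v, for every v vanishing
    outside A. *)
Lemma ae_eq0_off_set u A : L2 mu u -> measurable A ->
  (forall e, 0 < e -> exists v, [/\ L2 mu v, forall x, ~ A x -> v x = 0 &
     sqnorm2 mu (u - v) < e]) ->
  u = cst 0 %[ae mu in ~` A].
Proof.
move=> L2u mA uA; pose w x := u x * \1_(~` A) x.
have wle v : (forall x, ~ A x -> v x = 0) -> forall x, `|w x| <= `|(u - v) x|.
  move=> vA x; rewrite /w indicE; have [xA|xA] := boolP (x \in ~` A).
    by rewrite mulr1 /= !fctE vA ?subr0//; rewrite inE in xA.
  by rewrite mulr0 normr0.
have mw : measurable_fun setT w.
  apply: measurable_funM; first exact: L2_measurable.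
  by apply: measurable_indic; exact: measurableC.
have L2w : L2 mu w.
  apply: (L2_le L2u) => // x; rewrite -[u]subr0; apply: wle => //.
have w0 : w = cst 0 %[ae mu].
  apply: sqnorm2_eq0 => //; apply/ler_addgt0Pl => e e0; rewrite addr0.
  have [v [L2v vA /ltW]] := uA e e0; apply: le_trans.
  by apply: sqnorm2_le => //; [exact: L2B|exact: wle].
apply: filterS w0 => x /(_ I) + Ax.
by rewrite /w indicE mem_set// mulr1.
Qed.

End square_integrable_functions.

(** * Calculus of a Dirichlet form *)

Section dirichlet_form_calculus.
Context {d : measure_display} {R : realType} {M : metricMeasurableType d R}.
Context {mu : {measure set M -> \bar R}}.
Context {F : set (M -> R)} {E : (M -> R) -> (M -> R) -> R}.
Context (hE : dirichlet_form mu F E).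
Implicit Types (u v w f g h phi : M -> R).

Lemma F_L2 u : F u -> L2 mu u. Proof. by case: hE => -[+ _] _ _ _ _; apply. Qed.

Lemma F_measurable u : F u -> measurable_fun setT u.
Proof. by move=> /F_L2/L2_measurable. Qed.

Lemma F_ae u v : F u -> L2 mu v -> u = v %[ae mu] -> F v.
Proof. by case: hE => -[_ H] _ _ _ _; exact: H. Qed.

Lemma F_0 : F 0. Proof. by case: hE => _ []. Qed.

Lemma F_lin a u v : F u -> F v -> F (a *: u + v).
Proof. by case: hE => _ [_ H] _ _ _; exact: H. Qed.

Lemma F_D u v : F u -> F v -> F (u + v).
Proof. by move=> Fu Fv; rewrite -[u]scale1r; exact: F_lin. Qed.

Lemma F_Z a u : F u -> F (a *: u).
Proof. by move=> Fu; rewrite -[_ *: _]addr0; apply: F_lin => //; exact: F_0. Qed.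

Lemma F_B u v : F u -> F v -> F (u - v).
Proof. by move=> Fu Fv; rewrite -scaleN1r addrC; exact: F_lin. Qed.

Lemma E_sym u v : F u -> F v -> E u v = E v u.
Proof. by case: hE => _ _ _ [H _ _ _] _; exact: H. Qed.

Lemma E_linl a u v phi : F u -> F v -> F phi ->
  E (a *: u + v) phi = a * E u phi + E v phi.
Proof. by case: hE => _ _ _ [_ H _ _] _; exact: H. Qed.

Lemma E_ge0 u : F u -> 0 <= E u u.
Proof. by case: hE => _ _ _ [_ _ H _] _; exact: H. Qed.

Lemma E_ael u v phi : F u -> F v -> F phi -> u = v %[ae mu] -> E u phi = E v phi.
Proof. by case: hE => _ _ _ [_ _ _ H] _; exact: H. Qed.

Lemma E_Dl u v phi : F u -> F v -> F phi -> E (u + v) phi = E u phi + E v phi.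
Proof.
by move=> Fu Fv Fphi; have := E_linl 1 Fu Fv Fphi; rewrite scale1r mul1r.
Qed.

Lemma E_0l phi : F phi -> E 0 phi = 0.
Proof. by move=> Fphi; have := E_Dl F_0 F_0 Fphi; rewrite addr0; lra. Qed.

Lemma E_Zl a u phi : F u -> F phi -> E (a *: u) phi = a * E u phi.
Proof.
move=> Fu Fphi; have := E_linl a Fu F_0 Fphi.
by rewrite E_0l// !addr0.
Qed.

Lemma E_Bl u v phi : F u -> F v -> F phi -> E (u - v) phi = E u phi - E v phi.
Proof.
move=> Fu Fv Fphi; rewrite -[- v]scaleN1r addrC E_linl//; lra.
Qed.

Lemma E_Dr u v phi : F u -> F v -> F phi -> E phi (u + v) = E phi u + E phi v.
Proof.
by move=> Fu Fv Fphi; rewrite E_sym ?E_Dl ?(E_sym Fphi)//; exact: F_D.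
Qed.

Lemma E_Zr a u phi : F u -> F phi -> E phi (a *: u) = a * E phi u.
Proof.
by move=> Fu Fphi; rewrite E_sym ?E_Zl ?(E_sym Fphi)//; exact: F_Z.
Qed.

Lemma E_Br u v phi : F u -> F v -> F phi -> E phi (u - v) = E phi u - E phi v.
Proof.
by move=> Fu Fv Fphi; rewrite E_sym ?E_Bl ?(E_sym Fphi)//; exact: F_B.
Qed.

Lemma E_ae u v : F u -> F v -> u = v %[ae mu] -> E u u = E v v.
Proof.
by move=> Fu Fv uv; rewrite (E_ael Fu Fv)// E_sym// (E_ael Fu Fv).
Qed.

Lemma E_sqrZD a u v : F u -> F v ->
  E (u + a *: v) (u + a *: v) = E u u + 2 * a * E u v + a ^+ 2 * E v v.
Proof.
move=> Fu Fv; have Fav := F_Z a Fv.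
rewrite E_Dl ?E_Dr ?(E_sym Fav Fu) ?E_Zl ?E_Zr//; [lra|exact: F_D].
Qed.

Lemma E_sqrD u v : F u -> F v ->
  E (u + v) (u + v) = E u u + 2 * E u v + E v v.
Proof. by move=> Fu Fv; have := E_sqrZD 1 Fu Fv; rewrite scale1r; lra. Qed.

Lemma E_sqrB u v : F u -> F v ->
  E (u - v) (u - v) = E u u - 2 * E u v + E v v.
Proof. by move=> Fu Fv; have := E_sqrZD (- 1) Fu Fv; rewrite scaleN1r; lra. Qed.

Lemma E_sqrZ a u : F u -> E (a *: u) (a *: u) = a ^+ 2 * E u u.
Proof. by move=> Fu; rewrite E_Zl ?E_Zr// ?mulrA//; exact: F_Z. Qed.

(** E (u - v / t, u - v / t) >= 0, multiplied by t. *)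
Lemma E_amgm t u v : 0 < t -> F u -> F v ->
  2 * E u v <= t * E u u + t^-1 * E v v.
Proof.
move=> t0 Fu Fv; have := E_ge0 (F_D Fu (F_Z (- t^-1) Fv)).
rewrite E_sqrZD// => H.
have : 0 <= t * (E u u + 2 * - t^-1 * E u v + (- t^-1) ^+ 2 * E v v).
  by rewrite mulr_ge0// ltW.
have -> : t * (E u u + 2 * - t^-1 * E u v + (- t^-1) ^+ 2 * E v v) =
  t * E u u - 2 * E u v + t^-1 * E v v.
  by field; rewrite gt_eqF.
lra.
Qed.

Lemma E_amgmN t u v : 0 < t -> F u -> F v ->
  - (2 * E u v) <= t * E u u + t^-1 * E v v.
Proof.
move=> t0 Fu Fv; have := E_amgm t0 (F_Z (-1) Fu) Fv.
by rewrite E_sqrZ// E_Zl//; lra.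
Qed.

Lemma E_D_le2 u v : F u -> F v -> E (u + v) (u + v) <= 2 * E u u + 2 * E v v.
Proof.
by move=> Fu Fv; rewrite E_sqrD//; have := E_amgm ltr01 Fu Fv; rewrite invr1; lra.
Qed.

Lemma E_B_le2 u v : F u -> F v -> E (u - v) (u - v) <= 2 * E u u + 2 * E v v.
Proof.
by move=> Fu Fv; rewrite E_sqrB//; have := E_amgmN ltr01 Fu Fv; rewrite invr1; lra.
Qed.

Lemma E_half u v : F u -> F v ->
  E (2^-1 *: (u + v)) (2^-1 *: (u + v)) =
  2^-1 * E u u + 2^-1 * E v v - 4^-1 * E (u - v) (u - v).
Proof.
move=> Fu Fv; rewrite E_sqrZ ?(E_sqrD Fu Fv) ?(E_sqrB Fu Fv); [by field|exact: F_D].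
Qed.

Lemma E1_ge0 u : F u -> 0 <= E1 mu E u.
Proof. by move=> Fu; rewrite addr_ge0 ?E_ge0 ?sqnorm2_ge0. Qed.

Lemma E_le_E1 u : E u u <= E1 mu E u.
Proof. by rewrite lerDl sqnorm2_ge0. Qed.

Lemma sqnorm2_le_E1 u : F u -> sqnorm2 mu u <= E1 mu E u.
Proof. by move=> Fu; rewrite lerDr E_ge0. Qed.

Lemma E1_ae u v : F u -> F v -> u = v %[ae mu] -> E1 mu E u = E1 mu E v.
Proof.
by move=> Fu Fv uv; congr (_ + _); [exact: E_ae|
  apply: sqnorm2_ae => //; exact: F_measurable].
Qed.

Lemma E1_triangle u v w : F u -> F v -> F w ->
  E1 mu E (u - w) <= 2 * E1 mu E (u - v) + 2 * E1 mu E (v - w).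
Proof.
move=> Fu Fv Fw; rewrite /E1.
have := sqnorm2B (F_L2 Fu) (F_L2 Fv) (F_L2 Fw).
have := E_D_le2 (F_B Fu Fv) (F_B Fv Fw); rewrite addrA subrK; lra.
Qed.

Lemma E1_sym u v : F u -> F v -> E1 mu E (u - v) = E1 mu E (v - u).
Proof.
move=> Fu Fv; rewrite -opprB -scaleN1r /E1 E_sqrZ; last exact: F_B.
rewrite sqrrN expr1n mul1r; congr (_ + _).
by apply: eq_Rintegral => x _; rewrite scaleN1r /= sqrrN.
Qed.

(** Expanding E (g + (f - g)), the cross term is absorbed by [E_amgm] with a
    weight t that makes t * E (g, g) at most e / 2. *)
Lemma E_le_of_approx f C : F f ->
  (forall e, 0 < e -> exists g, [/\ F g, E (f - g) (f - g) < e & E g g <= C]) ->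
  E f f <= C.
Proof.
move=> Ff fg; have C0 : 0 <= C.
  by have [g [Fg _]] := fg 1 ltr01; apply: le_trans; exact: E_ge0.
apply/ler_addgt0Pl => e e0.
pose t := e / 2 / (C + 1); have t0 : 0 < t by rewrite !divr_gt0//; lra.
have s0 : 0 < (1 + t^-1) by rewrite addr_gt0// invr_gt0.
have [|g [Fg fgs gC]] := fg (e / 2 / (1 + t^-1)); first by rewrite !divr_gt0.
have := E_sqrD Fg (F_B Ff Fg); rewrite addrCA subrr addr0 => ->.
have := E_amgm t0 Fg (F_B Ff Fg).
have : t * E g g <= e / 2.
  apply: (@le_trans _ _ (t * (C + 1))); first by rewrite ler_wpM2l ?ltW//; lra.
  by rewrite /t divfK// gt_eqF//; lra.
by move: fgs; rewrite ltr_pdivlMr// => fgs; lra.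
Qed.

Lemma F_complete (u_ : nat -> M -> R) : (forall n, F (u_ n)) ->
  (forall e : R, 0 < e -> exists N, forall m n, (N <= m)%N -> (N <= n)%N ->
    E1 mu E (u_ m - u_ n) < e) ->
  exists2 u, F u & forall e, 0 < e -> exists N, forall n, (N <= n)%N ->
    E1 mu E (u_ n - u) < e.
Proof.
move=> Fu cu; case: hE => _ _ _ _ [/(_ u_ Fu cu)[u {}Fu uu] _].
exists u => // e e0; move/cvgrPdist_lt : uu => /(_ e e0)[N _ NE].
exists N => n Nn; have := NE n Nn; rewrite sub0r normrN.
exact: le_lt_trans (ler_norm _).
Qed.

(** Mazur's lemma, in the form in which energy bounds give membership.  Among
    the g in P close to f in L^2, choose one of almost least energy.  The
    midpoint of two such choices is again close to f, so its energy cannot be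
    much smaller; by the parallelogram law the choices form a Cauchy sequence
    for the norm of F, and its limit is f. *)
Lemma weak_closure (P : set (M -> R)) f C : P `<=` F ->
  (forall g h, P g -> P h -> P (2^-1 *: (g + h))) -> L2 mu f ->
  (forall e, 0 < e ->
     exists g, [/\ P g, sqnorm2 mu (g - f) < e & E g g <= C]) ->
  [/\ F f, E f f <= C & forall e, 0 < e -> exists2 g, P g & E1 mu E (f - g) < e].
Proof.
move=> PF Pmid L2f fP.
pose A e g := [/\ P g, sqnorm2 mu (g - f) < e & E g g <= C].
(* D is the limit, as e tends to 0, of the least energy on A e. *)
pose S := [set c | exists2 e, 0 < e & forall g, A e g -> c <= E g g].
have supS : has_sup S.
  split; first by exists 0; exists 1 => // g [Pg _ _]; apply/E_ge0/PF.
  by exists C => c [e e0 ec]; have [g Ag] := fP e e0;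
    apply: (le_trans (ec g Ag)); case: Ag.
pose D := sup S.
have D_low eta : 0 < eta ->
    exists2 e, 0 < e & forall g, A e g -> D - eta < E g g.
  move=> eta0; have [c [e e0 ec] Dc] := sup_adherent eta0 supS.
  by exists e => // g Ag; apply: lt_le_trans Dc _; exact: ec.
have D_up e : 0 < e -> exists g, A e g /\ E g g < D + e.
  move=> e0; apply/not_existsP => H.
  suff : D + e <= D by rewrite gerDl leNgt e0.
  apply: ub_le_sup; first by case: supS.
  exists e => // g Ag; rewrite leNgt; apply/negP => gD.
  exact: (H g).
pose eps n : R := n.+1%:R^-1.
have eps0 n : 0 < eps n by rewrite invr_gt0.
have eps_le e : 0 < e -> exists N, forall n, (N <= n)%N -> eps n < e.
  move=> e0; have [N _ NE] := near_infty_natSinv_lt (PosNum e0).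
  by exists N => n Nn; exact: NE.
have /choice[g_ g_P] : forall n, exists g, A (eps n) g /\ E g g < D + eps n.
  by move=> n; exact: D_up.
have Fg n : F (g_ n) by apply: PF; case: (g_P n) => -[].
have L2g n := F_L2 (Fg n).
have mid_sq g h : F g -> F h -> sqnorm2 mu (2^-1 *: (g + h) - f) <=
    2^-1 * sqnorm2 mu (g - f) + 2^-1 * sqnorm2 mu (h - f).
  move=> Fg' Fh; apply: sqnorm2_dominated.
  - by apply: L2B => //; exact: F_L2.
  - by apply: L2B => //; exact: F_L2.
  - by apply: (@L2_measurable _ _ _ mu); apply: L2B => //; apply: L2Z; exact/F_L2/F_D.
  - move=> x; rewrite /= !fctE; set a := g x; set b := h x; set c := f x.
    have -> : (2^-1 *: (a + b)) = 2^-1 * (a + b) by [].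
    by have := sqr_ge0 (a - b); nra.
have [e e0|g Fg' gg] := F_complete Fg.
  have eta0 : 0 < e / 12 by rewrite divr_gt0.
  have [e1 e10 e1D] := D_low _ eta0.
  have [|N NE] := eps_le (Num.min e1 (e / 12)); first by rewrite lt_min e10.
  exists N => m n /NE + /NE; rewrite !lt_min => /andP[m1 m2] /andP[n1 n2].
  have [[Pm fm Cm] Dm] := g_P m; have [[Pn fn Cn] Dn] := g_P n.
  have := E_half (Fg m) (Fg n).
  have := @e1D (2^-1 *: (g_ m + g_ n)).
  have : A e1 (2^-1 *: (g_ m + g_ n)).
    split; first exact: Pmid.
      by have := mid_sq _ _ (Fg m) (Fg n); lra.
    by rewrite E_half//; have := E_ge0 (F_B (Fg m) (Fg n)); lra.
  move=> H /(_ H) {H}.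
  have := sqnorm2B (L2g m) L2f (L2g n).
  have -> : sqnorm2 mu (f - g_ n) = sqnorm2 mu (g_ n - f).
    by apply: eq_Rintegral => x _ /=; rewrite -sqrrN opprB.
  rewrite /E1; lra.
have gf : g = f %[ae mu].
  have : g - f = cst 0 %[ae mu].
    have L2' := F_L2 Fg'; apply: sqnorm2_eq0; first exact: L2B.
    apply/ler_addgt0Pl => e e0; rewrite addr0.
    have e4 : 0 < e / 4 by rewrite divr_gt0.
    have [N1 H1] := gg _ e4; have [N2 H2] := eps_le _ e4.
    have {}H1 := H1 _ (leq_maxl N1 N2); have {}H2 := H2 _ (leq_maxr N1 N2).
    have := sqnorm2B L2' (L2g (maxn N1 N2)) L2f.
    have [[_ H3 _] _] := g_P (maxn N1 N2).
    have := sqnorm2_le_E1 (F_B Fg' (Fg (maxn N1 N2))).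
    by rewrite E1_sym//; lra.
  by apply: filterS => x /(_ I) /= gfx _; apply/eqP; rewrite -subr_eq0; exact/eqP.
have Ff := F_ae Fg' L2f gf.
have fg e : 0 < e -> exists n, E1 mu E (f - g_ n) < e.
  move=> e0; have [N NE] := gg _ e0; exists N; have := NE N (leqnn N).
  rewrite E1_sym//; apply: le_lt_trans; rewrite le_eqVlt; apply/orP; left.
  apply/eqP/E1_ae; [exact: F_B|exact: F_B|].
  by apply: filterS gf => x /(_ I) gfx _; rewrite !fctE gfx.
split=> // [|e e0].
  apply: E_le_of_approx => // e /fg[n fn]; exists (g_ n); split => //.
    by apply: le_lt_trans fn; exact: E_le_E1.
  by case: (g_P n) => -[].
by have [n fn] := fg e e0; exists (g_ n) => //; case: (g_P n) => -[].
Qed.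

End dirichlet_form_calculus.

(** * Compactly supported functions and lattice operations *)

Section compactly_supported_functions.
Context {d : measure_display} {R : realType} {M : metricMeasurableType d R}.
Implicit Types (u v : M -> R) (h : R -> R) (Omega : set M).

Lemma contraction_continuous h u : (forall x y, `|h x - h y| <= `|x - y|) ->
  continuous u -> continuous (h \o u).
Proof.
move=> hc cu x; apply/cvgrPdist_lt => e e0.
have /cvgrPdist_lt /(_ e e0) := cu x.
by apply: filterS => y; apply: le_lt_trans; exact: hc.
Qed.

Lemma C0_subsupport Omega u v : C0 Omega u -> continuous v ->
  (forall x, u x = 0 -> v x = 0) -> C0 Omega v.
Proof.
move=> [cu ku su] cv uv.
have vu : closure [set x | v x != 0] `<=` closure [set x | u x != 0].
  by apply: closureS => x /=; apply: contra_neq; exact: uv.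
split=> //; last exact: subset_trans su.
by apply: subclosed_compact ku vu; exact: closed_closure.
Qed.

Lemma C0_contraction Omega h u : (forall x y, `|h x - h y| <= `|x - y|) ->
  h 0 = 0 -> C0 Omega u -> C0 Omega (h \o u).
Proof.
move=> hc h0 C0u; apply: (C0_subsupport C0u) => [|x /= ->//].
by apply: contraction_continuous => //; case: C0u.
Qed.

Lemma C0_lin Omega a u v : C0 Omega u -> C0 Omega v -> C0 Omega (a *: u + v).
Proof.
move=> [cu ku su] [cv kv sv].
have sub : closure [set x | (a *: u + v) x != 0] `<=`
    closure [set x | u x != 0] `|` closure [set x | v x != 0].
  rewrite -closureU; apply: closureS => x /=; rewrite fctE => H.
  have [u0|u0] := eqVneq (u x) 0; [right|left] => //.
  by move: H; rewrite /= fctE u0 scaler0 add0r.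
split.
- move=> x; suff : a * u y + v y @[y --> x] --> a * u x + v x by [].
  by apply: cvgD; [apply: cvgMl_tmp; exact: cu|exact: cv].
- apply: subclosed_compact (compactU ku kv) sub; exact: closed_closure.
- by apply: subset_trans sub _ => x [/su|/sv].
Qed.

Lemma C0_bounded Omega u : C0 Omega u -> exists2 K, 0 < K & forall x, `|u x| <= K.
Proof.
move=> [cu ku _].
have /compact_bounded [K [_ KP]] : compact (u @` closure [set x | u x != 0]).
  by apply: continuous_compact => //; exact: continuous_subspaceT.
exists (`|K| + 1) => [|x]; first by rewrite ltr_wpDl.
have [->|ux] := eqVneq (u x) 0; first by rewrite normr0 addr_ge0.
apply: (KP (`|K| + 1)); first by rewrite (le_lt_trans (ler_norm K))// ltrDl.
by exists x => //; exact: subset_closure.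
Qed.

End compactly_supported_functions.

Section lattice_operations.
Context {d : measure_display} {R : realType} {M : metricMeasurableType d R}.
Context {mu : {measure set M -> \bar R}}.
Context {F : set (M -> R)} {E : (M -> R) -> (M -> R) -> R}.
Context (hE : dirichlet_form mu F E).
Implicit Types (u v f g phi : M -> R) (Omega : set M).

Local Notation FO := (dom_on mu F E).

Lemma dom_on_F Omega u : FO Omega u -> F u. Proof. by case. Qed.

Lemma dom_on_C0 Omega u : F u -> C0 Omega u -> FO Omega u.
Proof.
move=> Fu C0u; split=> // e e0; exists u => //.
rewrite /E1 subrr (E_0l hE); last exact: (F_0 hE).
by rewrite add0r /sqnorm2 /Rintegral integral0_eq// => x _; rewrite /= expr0n.
Qed.

Lemma dom_on_closed Omega f : F f ->
  (forall e, 0 < e -> exists2 g, FO Omega g & E1 mu E (f - g) < e) -> FO Omega f.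
Proof.
move=> Ff fg; split=> // e e0.
have e4 : 0 < e / 4 by rewrite divr_gt0.
have [g [Fg gv] fge] := fg _ e4; have [v [Fv C0v] gve] := gv _ e4.
exists v => //; apply: (le_lt_trans (E1_triangle hE Ff Fg Fv)); lra.
Qed.

Lemma dom_on_0 Omega : FO Omega 0.
Proof.
have e0 : [set x | (0 : M -> R) x != 0] = set0.
  by apply/seteqP; split=> x //=; rewrite eqxx.
apply: dom_on_C0; first exact: (F_0 hE).
split; rewrite ?e0 ?closure0; [|exact: compact0|exact: sub0set].
by move=> x; exact: cvg_cst.
Qed.

Lemma dom_on_lin Omega a u v : FO Omega u -> FO Omega v -> FO Omega (a *: u + v).
Proof.
move=> [Fu uO] [Fv vO]; split; first exact: (F_lin hE).
move=> e e0; pose K := 2 * (a ^+ 2 + 1).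
have K0 : 0 < K by rewrite mulr_gt0// ltr_wpDl ?sqr_ge0.
have eK : 0 < e / 2 / K by rewrite !divr_gt0.
have [u' [Fu' Cu'] uu'] := uO _ eK; have [v' [Fv' Cv'] vv'] := vO _ eK.
exists (a *: u' + v'); first by split; [exact: (F_lin hE)|exact: C0_lin].
have Fuu := F_B hE Fu Fu'; have Fvv := F_B hE Fv Fv'.
have -> : a *: u + v - (a *: u' + v') = a *: (u - u') + (v - v').
  by apply/funext => x; rewrite !fctE scalerBr opprD addrACA.
have := E_D_le2 hE (F_Z hE a Fuu) Fvv; rewrite (E_sqrZ hE)// => H1.
have : sqnorm2 mu (a *: (u - u') + (v - v')) <=
    (2 * a ^+ 2) * sqnorm2 mu (u - u') + 2 * sqnorm2 mu (v - v').
  apply: sqnorm2_dominated; [exact: (F_L2 hE)|exact: (F_L2 hE)| |].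
    by apply: (F_measurable hE); exact: (F_lin hE).
  move=> x; have := sqrD_le2 (a * (u - u') x) ((v - v') x).
  by rewrite exprMn mulrA.
move: uu' vv'; rewrite !ltr_pdivlMr// /K.
have := E1_ge0 hE Fuu; have := E1_ge0 hE Fvv.
have := E_ge0 hE Fuu; have := E_ge0 hE Fvv.
have := sqr_ge0 a; rewrite /E1.
have := sqnorm2_ge0 mu (u - u'); have := sqnorm2_ge0 mu (v - v').
set A := a ^+ 2; set x1 := E _ _; set x2 := E _ _.
set y1 := sqnorm2 _ _; set y2 := sqnorm2 _ _; move: H1.
rewrite -/A -/x1 -/x2; nra.
Qed.

Lemma dom_on_B Omega u v : FO Omega u -> FO Omega v -> FO Omega (u - v).
Proof.
by move=> Ou Ov; rewrite -scaleN1r addrC; exact: dom_on_lin.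
Qed.

Lemma dom_on_D Omega u v : FO Omega u -> FO Omega v -> FO Omega (u + v).
Proof. by move=> Ou Ov; rewrite -[u]scale1r; exact: dom_on_lin. Qed.

Lemma dom_on_Z Omega a u : FO Omega u -> FO Omega (a *: u).
Proof.
move=> Ou; rewrite -[_ *: _]addr0; apply: dom_on_lin => //; exact: dom_on_0.
Qed.

Lemma dom_on_weak_closure Omega f C : L2 mu f ->
  (forall e, 0 < e ->
     exists g, [/\ FO Omega g, sqnorm2 mu (g - f) < e & E g g <= C]) ->
  FO Omega f /\ E f f <= C.
Proof.
move=> L2f fO.
have [||Ff fC fg] := weak_closure hE _ _ L2f fO; first exact: dom_on_F.
  by move=> g h Og Oh; apply: dom_on_Z; exact: dom_on_D.
by split=> //; exact: dom_on_closed.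
Qed.

(** The Markov property is about truncation at height 1; height t follows by
    scaling. *)
Lemma F_unit_contraction t u : 0 < t -> F u ->
  let v := fun x => Num.min (Num.max (u x) 0) t in F v /\ E v v <= E u u.
Proof.
move=> t0 Fu v; case: hE => _ _ _ _ [_ /(_ _ (F_Z hE t^-1 Fu))].
set v1 := fun x => _ => -[Fv1 vu].
have -> : v = t *: v1.
  apply/funext => x; transitivity (t * v1 x); last by [].
  have -> : v1 x = Num.min (Num.max (t^-1 * u x) 0) 1 by [].
  rewrite minr_pMr ?ltW// mulr1 maxr_pMr ?ltW// mulr0.
  by rewrite mulVKf// gt_eqF.
split; first exact: (F_Z hE).
rewrite (E_sqrZ hE)//; apply: (@le_trans _ _ (t ^+ 2 * E (t^-1 *: u) (t^-1 *: u))).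
  by rewrite ler_wpM2l ?sqr_ge0.
by rewrite (E_sqrZ hE)// mulrA -exprMn divff ?gt_eqF// expr1n mul1r.
Qed.

Lemma E_upper_semicontinuous u eta : F u -> 0 < eta -> exists2 e, 0 < e &
  forall v, F v -> E (u - v) (u - v) < e -> E v v <= E u u + eta.
Proof.
move=> Fu eta0; have C0 := E_ge0 hE Fu.
pose t := eta / 2 / (E u u + 1); have t0 : 0 < t by rewrite !divr_gt0//; lra.
have s0 : 0 < 1 + t^-1 by rewrite addr_gt0// invr_gt0.
exists (eta / 2 / (1 + t^-1)); first by rewrite !divr_gt0.
move=> v Fv; rewrite ltr_pdivlMr// => uv.
have := E_sqrB hE Fu (F_B hE Fu Fv); rewrite opprB addrCA subrr addr0 => ->.
have := E_amgmN hE t0 Fu (F_B hE Fu Fv).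
have : t * E u u <= eta / 2.
  apply: (@le_trans _ _ (t * (E u u + 1))); first by rewrite ler_wpM2l ?ltW//; lra.
  by rewrite /t divfK// gt_eqF//; lra.
lra.
Qed.

Lemma maxr0_contraction (x y : R) : `|Num.max x 0 - Num.max y 0| <= `|x - y|.
Proof.
have := ler_norm (x - y); have := ler_norm (y - x); rewrite (distrC y).
move: `|x - y| => c yx xy; rewrite ler_norml.
by case: (lerP x 0); case: (lerP y 0) => ? ?; apply/andP; split; lra.
Qed.

Lemma F_C0_pos Omega u : F u -> C0 Omega u ->
  [/\ F u^\+, C0 Omega u^\+ & E u^\+ u^\+ <= E u u].
Proof.
move=> Fu C0u; have [K K0 uK] := C0_bounded C0u.
have [] := F_unit_contraction K0 Fu.
have -> : (fun x => Num.min (Num.max (u x) 0) K) = u^\+.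
  apply/funext => x; apply/min_idPl.
  by rewrite ge_max (ltW K0) andbT (le_trans (ler_norm _)).
move=> Fp Ep; split=> //.
by apply: (C0_contraction maxr0_contraction _ C0u); rewrite maxxx.
Qed.

Lemma sqnorm2_posB u v : L2 mu u -> L2 mu v ->
  sqnorm2 mu (u^\+ - v^\+) <= sqnorm2 mu (u - v).
Proof.
move=> L2u L2v; apply: sqnorm2_le; first exact: L2B.
  by apply: measurable_funB; apply: measurable_funrpos;
    [exact: L2_measurable L2u|exact: L2_measurable L2v].
by move=> x; exact: maxr0_contraction.
Qed.

Lemma L2_pos u : L2 mu u -> L2 mu u^\+.
Proof.
move=> L2u; apply: (L2_le L2u).
  by apply: measurable_funrpos; exact: L2_measurable L2u.
move=> x; have := maxr0_contraction (u x) 0; by rewrite maxxx !subr0.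
Qed.

(** For a continuous compactly supported v, hence bounded, v_+ is a truncation
    of v and the Markov property applies.  In general, approximate u by such
    functions v: the v_+ converge to u_+ in L^2 and their energies are bounded,
    so that u_+ belongs to F(Omega) by weak closure. *)
Lemma dom_on_pos Omega u : FO Omega u ->
  FO Omega u^\+ /\ E u^\+ u^\+ <= E u u.
Proof.
move=> [Fu uO]; have L2u := F_L2 hE Fu.
suff key eta : 0 < eta -> FO Omega u^\+ /\ E u^\+ u^\+ <= E u u + eta.
  split; first by case: (key 1 ltr01).
  by apply/ler_addgt0Pl => e /key[_]; rewrite addrC.
move=> eta0; apply: dom_on_weak_closure; first exact: L2_pos.
move=> e e0; have [e' e'0 ue'] := E_upper_semicontinuous Fu eta0.
have [|v [Fv C0v]] := uO (Num.min e e'); first by rewrite lt_min e0.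
rewrite lt_min => /andP[uve uve'].
have [Fp C0p Ep] := F_C0_pos Fv C0v; exists v^\+; split.
- exact: dom_on_C0.
- apply: le_lt_trans (sqnorm2_posB (F_L2 hE Fv) L2u) _.
  apply: le_lt_trans uve; rewrite (E1_sym hE)//.
  exact/(sqnorm2_le_E1 hE)/(F_B hE).
- apply: (le_trans Ep); apply: ue' => //.
  by apply: le_lt_trans uve'; exact: E_le_E1.
Qed.

Lemma dom_on_neg Omega u : FO Omega u -> FO Omega u^\-.
Proof. by move=> /(dom_on_Z (-1)) /dom_on_pos[]; rewrite scaleN1r funrposN. Qed.

Context (hreg : regular_form mu F E).

Lemma dom_on_setT u : F u -> FO setT u.
Proof. by move=> Fu; split=> // e e0; exact: hreg.1. Qed.

Lemma F_pos u : F u -> F u^\+ /\ E u^\+ u^\+ <= E u u.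
Proof. by move=> /dom_on_setT/dom_on_pos[/dom_on_F]. Qed.

Lemma F_neg u : F u -> F u^\-.
Proof. by move=> /dom_on_setT/dom_on_neg/dom_on_F. Qed.

(** The derivative at a = 0 of a |-> E (p + a q, p + a q) is nonnegative.  This
    turns contraction properties into signs of mixed energies: it applies
    whenever p is the image of p + a q under a normal contraction. *)
Lemma E_ge0_of_contraction p q : F p -> F q ->
  (forall a, 0 < a -> E p p <= E (p + a *: q) (p + a *: q)) -> 0 <= E p q.
Proof.
move=> Fp Fq pq; rewrite leNgt; apply/negP => Epq.
have Eq := E_ge0 hE Fq; pose a := - E p q / (E q q + 1).
have a0 : 0 < a by rewrite divr_gt0 ?oppr_gt0//; lra.
have aE : a * (E q q + 1) = - E p q by rewrite /a divfK// gt_eqF//; lra.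
have := pq a a0; rewrite (E_sqrZD hE)//.
have : a * (2 * E p q + a * E q q) < 0.
  rewrite pmulr_rlt0//; nra.
nra.
Qed.

Lemma E_pos_of_contraction p q : F p -> F q ->
  (forall a, 0 < a -> p = (p - a *: q)^\+) -> E p q <= 0.
Proof.
move=> Fp Fq pq.
suff : 0 <= E p (- q) by rewrite -scaleN1r (E_Zr hE)//; lra.
apply: E_ge0_of_contraction => //; first by rewrite -scaleN1r; exact: (F_Z hE).
move=> a a0; rewrite scalerN {1 2}(pq a a0).
by apply: (F_pos _).2; apply: (F_B hE) => //; exact: (F_Z hE).
Qed.

Lemma E_pos_neg_le0 u : F u -> E u^\+ u^\- <= 0.
Proof.
move=> Fu; apply: E_pos_of_contraction; [exact: (F_pos Fu).1|exact: F_neg|].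
move=> a a0; apply/funext => x.
transitivity (Num.max (u^\+ x - a * u^\- x) 0); last by [].
rewrite /funrpos /funrneg.
have [u0|u0] := lerP 0 (u x).
  by rewrite [Num.max (- _) _]max_r ?oppr_le0// mulr0 subr0 max_l.
rewrite [Num.max (- _) _]max_l ?oppr_ge0 1?ltW//.
by rewrite max_r//; nra.
Qed.

Lemma E_pos_le u : F u -> E u^\+ u^\+ <= E u u^\+.
Proof.
move=> Fu; have [Fp _] := F_pos Fu; have Fn := F_neg Fu.
rewrite -{3}(funrposBneg u) (E_Bl hE)//.
by have := E_pos_neg_le0 Fu; rewrite (E_sym hE)//; lra.
Qed.

Lemma E_neg_le u : F u -> E u u^\- <= - E u^\- u^\-.
Proof.
move=> Fu; have [Fp _] := F_pos Fu; have Fn := F_neg Fu.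
rewrite -{1}(funrposBneg u) (E_Bl hE)//.
by have := E_pos_neg_le0 Fu; lra.
Qed.

(** (u - t)_+, written out because subtracting the constant t leaves F. *)
Definition excess (t : R) u : M -> R := fun x => Num.max (u x - t) 0.

(** Write u = q + g - u_- with g = (u - t)_+ and q the truncation of u_+ at
    height t.  Truncating q + a g at t gives q back and (g - a u_-)_+ = g, so
    that E (q, g) >= 0 and E (g, u_-) <= 0. *)
Lemma excess_E Omega t u : 0 < t -> F u -> C0 Omega u ->
  F (excess t u) /\ E (excess t u) (excess t u) <= E u (excess t u).
Proof.
move=> t0 Fu C0u; have [Fp _] := F_pos Fu; have Fn := F_neg Fu.
set g := excess t u; pose q x := Num.min (Num.max (u x) 0) t.
have Fq : F q by case: (F_unit_contraction t0 Fu).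
have pqg : u^\+ = q + g.
  apply/funext => x; rewrite /funrpos /q /g /excess !fctE.
  rewrite !maxEle !minEle; case: ifP; case: ifP; case: ifP; lra.
have Fg : F g.
  have -> : g = u^\+ - q by rewrite pqg addrC addKr.
  exact: (F_B hE).
split=> //.
have Eqg : 0 <= E q g.
  apply: E_ge0_of_contraction => // a a0.
  have [_] := F_unit_contraction t0 (F_D hE Fq (F_Z hE a Fg)).
  suff -> : (fun x => Num.min (Num.max ((q + a *: g) x) 0) t) = q by [].
  apply/funext => x.
  transitivity (Num.min (Num.max (q x + a * g x) 0) t); first by [].
  rewrite /q /g /excess.
  have [ut|ut] := lerP (u x) t.
    rewrite [Num.max (u x - t) 0]max_r ?subr_le0// mulr0 addr0.
    rewrite [Num.max (Num.min _ _) 0]max_l//.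
      by rewrite min_l// ge_min lexx orbT.
    by rewrite le_min le_max lexx orbT ltW.
  rewrite [Num.max (u x - t) 0]max_l ?subr_ge0 ?ltW//.
  rewrite [Num.max (u x) 0]max_l; last lra.
  rewrite [Num.min (u x) t]min_r; last lra.
  by rewrite max_l ?min_r//; nra.
have Eng : E g u^\- <= 0.
  apply: E_pos_of_contraction => // a a0; apply/funext => x.
  transitivity (Num.max (g x - a * u^\- x) 0); last by [].
  rewrite /funrneg /g /excess.
  have [u0|u0] := lerP 0 (u x).
    rewrite [Num.max (- _) _]max_r ?oppr_le0// mulr0 subr0.
    by rewrite [RHS]max_l// le_max lexx orbT.
  rewrite [Num.max (- _) _]max_l ?oppr_ge0 1?ltW//.
  rewrite [Num.max (u x - t) 0]max_r; last lra.
  by rewrite max_r//; nra.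
rewrite -{1}(funrposBneg u) pqg (E_Bl hE)//; last exact: (F_D hE).
by rewrite (E_Dl hE)// (E_sym hE Fn Fg); lra.
Qed.

(** The support lies in {u >= t}, which is inside the open set {u > s}; the
    gap between s and t is what makes the support fit in an open level set. *)
Lemma excess_C0 Omega s t u : 0 < s -> s < t -> C0 Omega u ->
  C0 [set x | s < u x] (excess t u).
Proof.
move=> s0 st C0u.
have C0e : C0 Omega (excess t u).
  apply: (C0_contraction (h := fun y => Num.max (y - t) 0) _ _ C0u).
    move=> x y; apply: (le_trans (maxr0_contraction _ _)).
    by rewrite opprB addrA subrK.
  by rewrite max_r// sub0r oppr_le0; lra.
case: C0e => ce ke _; split=> //.
have cl : closed [set x | t <= u x].
  apply: (@preimage_closed _ _ u [set y | t <= y]); last exact: closed_ge.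
  by case: C0u => cu _ _ x _; exact: cu.
apply: (@subset_trans _ [set x | t <= u x]).
  rewrite (closure_id [set x | t <= u x]).1//.
  apply: closureS => x /=; apply: contra_neqT.
  by rewrite -ltNge => ut; rewrite /excess max_r//; lra.
by move=> x /=; exact: lt_le_trans.
Qed.

End lattice_operations.

(** * The torsion function *)

Section torsion_function.
Context {d : measure_display} {R : realType} {M : metricMeasurableType d R}.
Context {mu : {measure set M -> \bar R}}.
Context {F : set (M -> R)} {E : (M -> R) -> (M -> R) -> R}.
Context (hE : dirichlet_form mu F E) (hreg : regular_form mu F E).
Context {Omega : set M} (mO : measurable Omega) (muO : (mu Omega < +oo)%E).
Implicit Types (u v phi : M -> R).

Local Notation FO := (dom_on mu F E).
Local Notation mean u := (\int[mu]_(x in Omega) u x).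

Lemma dom_on_vanish u : FO Omega u -> u = cst 0 %[ae mu in ~` Omega].
Proof.
move=> [Fu uO]; apply: ae_eq0_off_set => //; first exact: (F_L2 hE).
move=> e /uO [v [Fv [_ _ sv]] uv]; exists v; split; first exact: (F_L2 hE).
- move=> x xO; apply/eqP; apply/negPn/negP => vx; apply: xO; apply: sv.
  exact: subset_closure.
- by apply: le_lt_trans uv; exact/(sqnorm2_le_E1 hE)/(F_B hE).
Qed.

Lemma dom_on_integrable u : FO Omega u -> mu.-integrable Omega (EFin \o u).
Proof. by move=> [Fu _]; apply: L2_integrable_on => //; exact: (F_L2 hE). Qed.

Lemma dom_on_integral u : FO Omega u ->
  (\int[mu]_x (u x)%:E)%E = (mean u)%:E.
Proof.
move=> Ou; rewrite fineK; last by apply: integrable_fin_num => //;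
  exact: dom_on_integrable.
have mu_ : measurable_fun setT (EFin \o u).
  by apply/measurable_EFinP; exact: (F_measurable hE (dom_on_F Ou)).
rewrite [RHS]integral_mkcond; apply: ae_eq_integral => //.
  by apply/(measurable_restrictT _ mO); exact: measurable_funTS.
apply: filterS (dom_on_vanish Ou) => x ux _; rewrite patchE.
by case: ifPn => //; rewrite notin_setE => /ux /= ->.
Qed.

Lemma mean_D u v : FO Omega u -> FO Omega v -> mean (u + v) = mean u + mean v.
Proof. by move=> Ou Ov; rewrite -RintegralD//; exact: dom_on_integrable. Qed.

Lemma mean_Z a u : FO Omega u -> mean (a *: u) = a * mean u.
Proof. by move=> Ou; rewrite -RintegralZl//; exact: dom_on_integrable. Qed.

Lemma weak_solutionP u : weak_solution mu F E Omega u <-> FO Omega u /\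
  forall phi, FO Omega phi -> (\forall x \ae mu, 0 <= phi x) -> E u phi = mean phi.
Proof.
split=> -[Ou uphi]; split=> // phi Ophi phi0.
  by apply/EFin_inj; rewrite -dom_on_integral//; exact: uphi.
by rewrite dom_on_integral// uphi.
Qed.

Context {Lam : R} (Lam0 : 0 < Lam)
  (poincare : forall u, FO Omega u -> Lam * sqnorm2 mu u <= E u u).

Let energy u := E u u - 2 * mean u.

Let energy_half u v : FO Omega u -> FO Omega v ->
  E (u - v) (u - v) = 2 * energy u + 2 * energy v - 4 * energy (2^-1 *: (u + v)).
Proof.
move=> Ou Ov; rewrite /energy mean_Z ?mean_D//; last exact: (dom_on_D hE).
by rewrite (E_half hE (dom_on_F Ou) (dom_on_F Ov)); field.
Qed.

Let E1_le_E u : FO Omega u -> E1 mu E u <= (1 + Lam^-1) * E u u.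
Proof.
move=> Ou; rewrite mulrDl mul1r lerD2l.
by rewrite mulrC ler_pdivlMr// mulrC poincare.
Qed.

Let energy_inf : exists c, (forall u, FO Omega u -> c <= energy u) /\
  forall e, 0 < e -> exists2 u, FO Omega u & energy u < c + e.
Proof.
pose S := energy @` FO Omega.
have infS : has_inf S.
  split; first by exists (energy 0); exists 0 => //; exact: (dom_on_0 hE).
  exists (- (Lam^-1 * fine (mu Omega))) => _ [u Ou <-].
  have := Rintegral_le_sqnorm2 (F_L2 hE (dom_on_F Ou)) mO muO Lam0.
  rewrite invfM => H; have := poincare Ou; rewrite /energy.
  set I := mean u in H *; set S1 := sqnorm2 _ _ in H *.
  set T := fine _ in H *; nra.
exists (inf S); split=> [u Ou|e e0].
  by apply: ge_inf; [exact: infS.2|exists u].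
by have [_ [u Ou <-] uS] := inf_adherent e0 infS; exists u.
Qed.

(** A parabola s |-> 2 s q + s^2 K touching 0 from above at s = 0 has slope 0
    there; the proof evaluates it near its vertex, with K + 1 in place of K to
    avoid dividing by 0. *)
Lemma quadratic_ge0 (q K : R) : 0 <= K ->
  (forall s, 0 <= 2 * s * q + s ^+ 2 * K) -> q = 0.
Proof.
move=> K0 H; have K1 : 0 < K + 1 by lra.
have := H (- q / (K + 1)).
have -> : 2 * (- q / (K + 1)) * q + (- q / (K + 1)) ^+ 2 * K =
  - (q ^+ 2 * ((K + 2) / (K + 1) ^+ 2)) by field; rewrite gt_eqF.
rewrite oppr_ge0 pmulr_lle0; last by rewrite divr_gt0 ?exprn_gt0//; lra.
by move=> q0; apply/eqP; rewrite -sqrf_eq0 eq_le q0 sqr_ge0.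
Qed.

(** Minimise the energy along v_n.  The parallelogram identity [energy_half]
    and the Poincare inequality make v_n Cauchy; the variational inequality
    energy (v_n + s phi) >= inf passes to the limit and, being quadratic in s,
    yields the equation. *)
Lemma torsion_exists : exists2 u, FO Omega u &
  forall phi, FO Omega phi -> E u phi = mean phi.
Proof.
have [c [cmin capp]] := energy_inf.
have /choice[v_ vP] : forall n, exists u, FO Omega u /\ energy u < c + n.+1%:R^-1.
  by move=> n; have [|u] := capp n.+1%:R^-1; [rewrite invr_gt0|exists u].
have Ov n : FO Omega (v_ n) by case: (vP n).
have Fv n := dom_on_F (Ov n).
have eps_le e : 0 < e -> exists N, forall n, (N <= n)%N -> n.+1%:R^-1 < e :> R.
  move=> e0; have [N _ NE] := near_infty_natSinv_lt (PosNum e0).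
  by exists N => n Nn; exact: NE.
have L0 : 0 < 1 + Lam^-1 by rewrite addr_gt0 ?invr_gt0.
have [e e0|u Fu uv] := F_complete hE Fv.
  have [|N NE] := eps_le (e / 4 / (1 + Lam^-1)); first by rewrite !divr_gt0.
  exists N => m n /NE + /NE; rewrite !ltr_pdivlMr// => m1 n1.
  apply: (le_lt_trans (E1_le_E (dom_on_B hE (Ov m) (Ov n)))).
  rewrite energy_half//.
  have := cmin _ (dom_on_Z hE 2^-1 (dom_on_D hE (Ov m) (Ov n))).
  have [_ Em] := vP m; have [_ En] := vP n => Emid.
  apply: (@le_lt_trans _ _ ((1 + Lam^-1) * (2 * m.+1%:R^-1 + 2 * n.+1%:R^-1))).
    rewrite ler_wpM2l//; first exact: ltW.
    by move: Em En Emid {m1 n1}; set am := m.+1%:R^-1; set an := n.+1%:R^-1; lra.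
  move: m1 n1 {Em En}; set am := m.+1%:R^-1; set an := n.+1%:R^-1; lra.
have Ou : FO Omega u.
  apply: (dom_on_closed hE) => // e /uv[N NE].
  by exists (v_ N) => //; rewrite (E1_sym hE)//; exact: NE.
exists u => // phi Ophi; have Fphi := dom_on_F Ophi.
have Ephi := E_ge0 hE Fphi.
apply/eqP; rewrite -subr_eq0; apply/eqP; apply: (quadratic_ge0 Ephi) => s.
apply/ler_addgt0Pl => e e0; set K := E phi phi in Ephi *.
have K1 : 0 < s ^+ 2 * K + 1 by rewrite ltr_wpDl// mulr_ge0// sqr_ge0.
(* The weight t makes the term s^2 E (phi, phi) / t of [E_amgm] at most e / 4. *)
pose t := (s ^+ 2 * K + 1) * 4 / e; have t0 : 0 < t by rewrite divr_gt0 ?mulr_gt0.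
have [|N1 H1] := eps_le (e / 4); first by rewrite divr_gt0.
have [|N2 H2] := uv (e / 4 / t); first by rewrite divr_gt0// divr_gt0.
pose n := maxn N1 N2.
have {}H1 := H1 n (leq_maxl _ _); have {}H2 := H2 n (leq_maxr _ _).
have Fw := F_B hE (Fv n) Fu.
have := cmin _ (dom_on_D hE (Ov n) (dom_on_Z hE s Ophi)).
rewrite /energy (E_sqrZD hE)// mean_D ?mean_Z//; last exact: (dom_on_Z hE).
have [_] := vP n; rewrite /energy -/K => Evn Emin.
have := E_amgm hE t0 Fw (F_Z hE s Fphi).
rewrite (E_sqrZ hE)// (E_Zr hE)// (E_Bl hE)//.
have : t * E (v_ n - u) (v_ n - u) <= e / 4.
  rewrite mulrC -ler_pdivlMr//; apply: ltW; apply: le_lt_trans H2.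
  exact: E_le_E1.
have : t^-1 * (s ^+ 2 * K) <= e / 4.
  rewrite ler_pdivrMl// (_ : t * (e / 4) = s ^+ 2 * K + 1) ?lerDl//.
  by rewrite /t; field; rewrite gt_eqF.
rewrite -/K; set X := E (v_ n) phi; set Y := E u phi; set Z := mean phi.
move: Evn Emin; rewrite -/X -/Z; set A := E (v_ n) (v_ n); set B := mean (v_ n).
set a := n.+1%:R^-1 in H1 *; lra.
Qed.

(** Testing with u_- gives 0 <= \int u_- = E (u, u_-) <= - E (u_-, u_-). *)
Lemma torsion_ge0 u : FO Omega u ->
  (forall phi, FO Omega phi -> (\forall x \ae mu, 0 <= phi x) -> E u phi = mean phi) ->
  u^\- = cst 0 %[ae mu].
Proof.
move=> Ou uphi; have On := dom_on_neg hE Ou.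
apply: sqnorm2_eq0; first exact/(F_L2 hE)/(dom_on_F On).
rewrite -(pmulr_rle0 _ Lam0); apply: (le_trans (poincare On)).
have := E_neg_le hE hreg (dom_on_F Ou); rewrite uphi//; last first.
  by apply: aeW => x; exact: funrneg_ge0.
have : 0 <= mean u^\- by apply: Rintegral_ge0 => x _; exact: funrneg_ge0.
lra.
Qed.

(** Weak solutions are tested against nonnegative functions only, so the
    difference w is tested against w_+ and w_- separately. *)
Lemma torsion_unique u v : weak_solution mu F E Omega u ->
  weak_solution mu F E Omega v -> v = u %[ae mu].
Proof.
move=> /weak_solutionP[Ou uphi] /weak_solutionP[Ov vphi].
pose w := v - u; have Ow : FO Omega w := dom_on_B hE Ov Ou.
have [Op _] := dom_on_pos hE Ow; have On := dom_on_neg hE Ow.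
have Ew phi : FO Omega phi -> (forall x, 0 <= phi x) -> E w phi = 0.
  move=> Ophi phi0; have phi0' := aeW mu phi0.
  rewrite (E_Bl hE (dom_on_F Ov) (dom_on_F Ou) (dom_on_F Ophi)).
  by rewrite uphi// vphi// subrr.
have : w = cst 0 %[ae mu].
  apply: sqnorm2_eq0; first exact/(F_L2 hE)/(dom_on_F Ow).
  rewrite -(pmulr_rle0 _ Lam0); apply: (le_trans (poincare Ow)).
  rewrite -{2}(funrposBneg w) (E_Br hE (dom_on_F Op) (dom_on_F On) (dom_on_F Ow)).
  by rewrite (Ew _ Op (funrpos_ge0 w)) (Ew _ On (funrneg_ge0 w)) subrr.
by apply: filterS => x /(_ I) wx _; apply/eqP; rewrite -subr_eq0; exact/eqP.
Qed.

(** The representative is the positive part of the minimiser, nonnegative at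
    every point: then its negative part vanishes identically, and so does the
    tail of that part for any jump kernel. *)
Lemma torsion_function_exists : exists u, [/\ the_weak_solution mu F E Omega u,
  FO Omega u, forall x, 0 <= u x &
  forall phi, FO Omega phi -> E u phi = mean phi].
Proof.
have [v Ov vphi] := torsion_exists.
have vneg := torsion_ge0 Ov (fun phi Ophi _ => vphi phi Ophi).
have [Op _] := dom_on_pos hE Ov.
have vp : v^\+ = v %[ae mu].
  apply: filterS vneg => x /(_ I) vx _.
  by rewrite -[in RHS](funrposBneg v) !fctE vx subr0.
have pphi phi : FO Omega phi -> E v^\+ phi = mean phi.
  move=> Ophi; rewrite -vphi//.
  exact: (E_ael hE (dom_on_F Op) (dom_on_F Ov) (dom_on_F Ophi) vp).
have ws : weak_solution mu F E Omega v^\+.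
  by apply/weak_solutionP; split=> // phi Ophi _; exact: pphi.
exists v^\+; split=> //; split=> // u; exact: torsion_unique.
Qed.

End torsion_function.

(** * Balls and bump functions *)

Section metric_balls.
Context {d : measure_display} {R : realType} {M : metricMeasurableType d R}.
Context {mu : {measure set M -> \bar R}}.
Context (hM : metric_measure_space mu) (hballs : @balls_precompact d R M).
Implicit Types (x y z : M) (U : set M).

Lemma open_measurable_borel U : open U -> measurable U.
Proof.
by move=> oU; case: hM => + _ _ _ _; rewrite /borel => ->; exact: sub_sigma_algebra.
Qed.

Lemma mdist_contraction x y z : `|mdist x y - mdist x z| <= mdist y z.
Proof.
rewrite ler_norml; have := metric_triangle x y z; have := metric_triangle x z y.
by rewrite (metric_sym z y) => ? ?; apply/andP; split; lra.
Qed.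

Lemma metric_ball_open x (r : R) : open (ball x r).
Proof.
rewrite openE => y; rewrite ballEmdist /= => xy.
apply/nbhs_ballP; exists (r - mdist x y); first by rewrite /= subr_gt0.
move=> z; rewrite !ballEmdist /= => yz.
by apply: (le_lt_trans (metric_triangle x y z)); lra.
Qed.

Lemma mdist_continuous x : continuous (mdist x : M -> R).
Proof.
move=> y; apply/cvgrPdist_lt => e e0; apply/nbhs_ballP; exists e => // z.
by rewrite ballEmdist /=; apply: le_lt_trans; exact: mdist_contraction.
Qed.

Lemma ball_measurable x (r : R) : measurable (ball x r).
Proof. exact/open_measurable_borel/metric_ball_open. Qed.

Lemma ball_closure_compact x (r : R) : 0 < r -> compact (closure (ball x r)).
Proof. by move=> /(hballs x); rewrite precompactE. Qed.

Lemma ball_lty x (r : R) : 0 < r -> (mu (ball x r) < +oo)%E.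
Proof.
move=> r0; case: hM => _ _ _ [muK _] _.
apply: (@le_lt_trans _ _ (mu (closure (ball x r)))).
  apply: le_measure; rewrite ?inE; [exact: ball_measurable| |exact: subset_closure].
  rewrite -(setCK (closure _)); apply: measurableC; apply: open_measurable_borel.
  exact/closed_openC/closed_closure.
by apply: muK => //; exact: ball_closure_compact.
Qed.

Lemma open_mu_gt0 U : open U -> U !=set0 -> (0 < mu U)%E.
Proof. by case: hM => _ _ _ _; exact. Qed.

Lemma ball_gt0 x (r : R) : 0 < r -> (0 < mu (ball x r))%E.
Proof.
move=> r0; apply: open_mu_gt0; first exact: metric_ball_open.
by exists x; exact: ballxx.
Qed.

Lemma ball_fine_gt0 x (r : R) : 0 < r -> 0 < fine (mu (ball x r)).
Proof. by move=> r0; rewrite fine_gt0// ball_gt0// ball_lty. Qed.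

Lemma ball_fineK x (r : R) : 0 < r -> (fine (mu (ball x r)))%:E = mu (ball x r).
Proof. by move=> r0; rewrite fineK// ge0_fin_numE// ball_lty. Qed.

End metric_balls.

Section bump_functions.
Context {d : measure_display} {R : realType} {M : metricMeasurableType d R}.
Context {mu : {measure set M -> \bar R}}.
Context {F : set (M -> R)} {E : (M -> R) -> (M -> R) -> R}.
Context (hballs : @balls_precompact d R M).
Context (hE : dirichlet_form mu F E) (hreg : regular_form mu F E).

(** Regularity only provides elements of F that are uniformly close to a given
    function chi of C_0.  Taking chi >= 2 on the half ball and chi = 0 beyond
    3 r / 4, an approximant v within 1/2 of chi is below 1/2 where chi
    vanishes, so that (v - 1/2)_+ is supported in the ball. *)
Lemma bump_exists (x : M) (r : R) : 0 < r -> exists psi, [/\ F psi,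
  C0 (ball x r) psi, forall y, 0 <= psi y & forall y, ball x (r / 2) y -> 1 <= psi y].
Proof.
move=> r0; pose chi (y : M) : R := 8 / r * Num.max (3 / 4 * r - mdist x y) 0.
have r8 : 0 < 8 / r by rewrite divr_gt0.
have chi_far y : 3 / 4 * r <= mdist x y -> chi y = 0.
  by move=> xy; rewrite /chi max_r ?mulr0//; lra.
have cl : closed [set y | mdist x y <= 3 / 4 * r].
  apply: (@preimage_closed _ _ (mdist x) [set t | t <= 3 / 4 * r]).
    by move=> y _; exact: mdist_continuous.
  exact: closed_le.
have sub : [set y | mdist x y <= 3 / 4 * r] `<=` ball x r.
  by move=> y; rewrite ballEmdist /=; lra.
have kc : compact [set y | mdist x y <= 3 / 4 * r].
  apply: (subclosed_compact cl (@ball_closure_compact _ _ _ hballs x _ r0)).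
  exact: subset_trans sub (@subset_closure _ _).
have C0chi : C0 setT chi.
  split=> //.
    move=> y; apply: cvgMl_tmp.
    apply: (@contraction_continuous _ _ _ (fun t => Num.max (3 / 4 * r - t) 0)
      (mdist x)); last exact: mdist_continuous.
    move=> s t; apply: (le_trans (maxr0_contraction _ _)).
    by rewrite opprB addrC addrA subrK distrC.
  apply: subclosed_compact kc _; first exact: closed_closure.
  rewrite [X in _ `<=` X](closure_id _).1//; apply: closureS => y /=.
  by apply: contra_neqT; rewrite -ltNge => /ltW; exact: chi_far.
have half0 : 0 < 1 / 2 :> R by rewrite divr_gt0.
have [v [Fv C0v] vchi] := hreg.2 chi (1 / 2) C0chi half0.
have [Fe _] := excess_E hE hreg half0 Fv C0v.
have [ce ke _] : C0 setT (excess (1 / 2) v).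
  apply: (C0_contraction (h := fun y => Num.max (y - 1 / 2) 0) _ _ C0v).
    by move=> s t; apply: (le_trans (maxr0_contraction _ _)); rewrite opprB addrA subrK.
  by rewrite max_r//; lra.
have vnear y : `|chi y - v y| < 1 / 2 by exact: vchi.
exists (excess (1 / 2) v); split=> //.
- split=> //; apply: subset_trans sub.
  rewrite [X in _ `<=` X](closure_id _).1//; apply: closureS => y /=.
  apply: contra_neqT; rewrite -ltNge => /ltW /chi_far chi0.
  have := vnear y; rewrite chi0 sub0r normrN => /ltW; rewrite ler_norml => /andP[_ ?].
  by rewrite /excess max_r// subr_le0.
- by move=> y; rewrite /excess le_max lexx orbT.
- move=> y; rewrite ballEmdist /= => xy.
  have : 2 <= chi y.
    rewrite /chi max_l; last lra.
    by rewrite mulrAC ler_pdivlMr//; nra.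
  have := vnear y; rewrite ltr_norml => /andP[_ ? ?].
  by rewrite /excess le_max; apply/orP; left; lra.
Qed.

End bump_functions.

(** * Upper bound for the torsion function *)

Section de_giorgi_iteration.
Context {R : realType}.

(** Along t_k = L + 8 L (1 - 2^-k), with increments 4 h_k for h_k = L 2^-k, the
    values a (t_k) decay like rho^k with rho = 2^(-1/nu).  This ratio is chosen
    so that (rho^k)^(2 nu) = 4^-k compensates the factor h_k^-2; the induction
    then closes as soon as K <= rho L^2.  All t_k are below 9 L. *)
Lemma de_giorgi_iteration (a : R -> R) (K nu L : R) : 0 < nu -> 0 < L ->
  (forall t, 0 <= a t <= 1) ->
  (forall t h, 0 < t -> 0 < h ->
     h ^+ 2 * a (t + 4 * h) <= K * a t * a t `^ (2 * nu)) ->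
  0 <= K -> K <= 2 `^ (- nu^-1) * L ^+ 2 ->
  (forall s t, s <= t -> a t <= a s) ->
  a (9 * L) = 0.
Proof.
move=> nu0 L0 a01 step K0 KL anti.
set rho := 2 `^ (- nu^-1) in KL.
have rho0 : 0 < rho by rewrite powR_gt0.
have rho1 : rho < 1.
  rewrite /rho powRN invf_lt1 ?powR_gt0//.
  rewrite -[X in X < _](powRr0 2) /powR ltNge.
  have /negbTE -> : (2 : R) != 0 by [].
  by rewrite -ltNge ltr_expR mul0r mulr_gt0 ?invr_gt0 ?ln_gt0// ltr1n.
pose t k : R := L + 8 * L * (1 - 2^-1 ^+ k).
have t0 k : 0 < t k.
  have k1 : 2^-1 ^+ k <= 1 :> R by apply: exprn_ile1; lra.
  have : 0 <= L * (1 - 2^-1 ^+ k) by rewrite mulr_ge0 ?subr_ge0// ltW.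
  by rewrite /t; lra.
have tS k : t k.+1 = t k + 4 * (L * 2^-1 ^+ k) by rewrite /t exprS; field.
have key k : a (t k) <= rho ^+ k.
  elim: k => [|k IH]; first by rewrite expr0; case/andP: (a01 (t 0%N)).
  have h0 : 0 < L * 2^-1 ^+ k by rewrite mulr_gt0// exprn_gt0.
  have := step _ _ (t0 k) h0; rewrite -tS => H.
  have ak0 : 0 <= a (t k) by case/andP: (a01 (t k)).
  have pk : a (t k) `^ (2 * nu) <= (rho ^+ k) `^ (2 * nu).
    by rewrite ge0_ler_powR ?nnegrE ?mulr_ge0 ?exprn_ge0 ?(ltW rho0) ?(ltW nu0).
  have rk : (rho ^+ k) `^ (2 * nu) = (2^-1 ^+ k) ^+ 2.
    rewrite -powR_mulrn ?ltW// /rho -!powRrM.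
    have -> : - nu^-1 * (k%:R * (2 * nu)) = - (k * 2)%:R.
      by rewrite natrM; field; rewrite gt_eqF.
    by rewrite powRN powR_mulrn// -exprVn exprM.
  rewrite -(ler_pM2l (exprn_gt0 2 h0)); apply: (le_trans H).
  apply: (@le_trans _ _ (K * rho ^+ k * (2^-1 ^+ k) ^+ 2)).
    rewrite -rk -!mulrA ler_wpM2l// ler_pM//; exact: powR_ge0.
  rewrite exprMn (exprS rho).
  rewrite [leRHS](_ : _ = (rho * L ^+ 2) * rho ^+ k * (2^-1 ^+ k) ^+ 2); last by ring.
  by rewrite !ler_wpM2r// exprn_ge0// ltW.
have a9 k : a (9 * L) <= rho ^+ k.
  apply: le_trans (key k); apply: anti; rewrite /t.
  have : 0 <= L * 2^-1 ^+ k by rewrite mulr_ge0 ?exprn_ge0 ?ltW.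
  lra.
apply/eqP; rewrite eq_le; apply/andP; split; last by case/andP: (a01 (9 * L)).
have /cvgrPdist_lt cv : rho ^+ n @[n --> \oo] --> (0 : R).
  by apply: cvg_expr; rewrite ger0_norm// ltW.
apply/ler_addgt0Pl => e e0; rewrite addr0.
have [N _ /(_ N (leqnn N)) HN] := cv e e0; apply: (le_trans (a9 N)); apply: ltW.
by move: HN; rewrite /= sub0r normrN; apply: le_lt_trans; exact: ler_norm.
Qed.

End de_giorgi_iteration.

Section torsion_bound.
Context {d : measure_display} {R : realType} {M : metricMeasurableType d R}.
Context {mu : {measure set M -> \bar R}}.
Context {F : set (M -> R)} {E : (M -> R) -> (M -> R) -> R}.
Context (hM : metric_measure_space mu).
Context (hE : dirichlet_form mu F E) (hreg : regular_form mu F E).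
Implicit Types (u v phi : M -> R) (D : set M).

Local Notation FO := (dom_on mu F E).

Lemma sqnorm2_0 : sqnorm2 mu (cst 0) = 0.
Proof.
by rewrite /sqnorm2 /Rintegral integral0_eq// => x _; rewrite /= expr0n.
Qed.

Lemma poincare_of_lambda1 u D (Lam : R) : (Lam%:E <= lambda1 mu F E D)%E ->
  FO D u -> Lam * sqnorm2 mu u <= E u u.
Proof.
move=> LD Ou; have Fu := dom_on_F Ou; have L2u := F_L2 hE Fu.
have [u0|u0] := pselect (u = cst 0 %[ae mu]).
  rewrite (sqnorm2_ae (L2_measurable L2u) _ u0)// sqnorm2_0 mulr0.
  exact: (E_ge0 hE).
have sq0 : 0 < sqnorm2 mu u.
  by rewrite ltNge; apply/negP => /(sqnorm2_eq0 L2u).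
rewrite -ler_pdivlMr// -lee_fin; apply: (le_trans LD).
by apply: ereal_inf_lbound; exists u.
Qed.

Context {B : set M} (oB : open B) (muB : (mu B < +oo)%E) (muB0 : (0 < mu B)%E).
Context {Lam nu : R} (Lam0 : 0 < Lam) (nu0 : 0 < nu).
Context (faber_krahn : forall D, open D -> D !=set0 -> D `<=` B ->
  ((Lam * (fine (mu B) / fine (mu D)) `^ nu)%:E <= lambda1 mu F E D)%E).

Let mB : measurable B. Proof. exact: (open_measurable_borel hM). Qed.

Let fine_le A A' : measurable A -> measurable A' -> A `<=` A' -> A' `<=` B ->
  fine (mu A) <= fine (mu A').
Proof.
move=> mA mA' AA' A'B; rewrite fine_le ?le_measure ?inE//.
  rewrite ge0_fin_numE//; apply: le_lt_trans muB.
  by rewrite le_measure ?inE//; exact: subset_trans A'B.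
rewrite ge0_fin_numE//; apply: le_lt_trans muB.
by rewrite le_measure ?inE//.
Qed.

Let fineK_sub A : measurable A -> A `<=` B -> (fine (mu A))%:E = mu A.
Proof.
move=> mA AB; rewrite fineK// ge0_fin_numE//; apply: le_lt_trans muB.
by rewrite le_measure ?inE.
Qed.

Let fine_muB0 : 0 < fine (mu B).
Proof. by rewrite fine_gt0// muB0 muB. Qed.

Lemma poincare_on_ball u : FO B u -> Lam * sqnorm2 mu u <= E u u.
Proof.
apply: poincare_of_lambda1; have BN0 : B !=set0.
  by apply/set0P/eqP => B0; move: muB0; rewrite B0 measure0 ltxx.
have := faber_krahn oB BN0 (@subset_refl _ B).
by rewrite divff ?gt_eqF// powR1 mulr1.
Qed.

Context {u : M -> R} (Ou : FO B u)
  (uphi : forall phi, FO B phi -> E u phi = \int[mu]_(x in B) phi x).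

Let mu_ : measurable_fun setT u. Proof. exact: (F_measurable hE (dom_on_F Ou)). Qed.

Let level t := B `&` [set x | t <= u x].

Let mge v (t : R) : measurable_fun setT v -> measurable (B `&` [set x | t <= v x]).
Proof.
by move=> mv; apply: measurableI => //; exact: superlevel_measurable.
Qed.

Let m t := fine (mu (level t)).

(** With g = (v - t)_+, E (g) <= E (v, g) = E (v - u, g) + E (u, g), where
    E (u, g) is the integral of g, and half of E (g) absorbs E (v - u, g). *)
Lemma excess_energy v s t : 0 < s -> s < t -> F v -> C0 B v ->
  E (excess t v) (excess t v) <= E (v - u) (v - u) +
    2 * \int[mu]_(x in [set x | s < v x]) (excess t v x).
Proof.
move=> s0 st Fv C0v; have t0 := lt_trans s0 st.
have [Fg Eg] := excess_E hE hreg t0 Fv C0v.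
have C0g := excess_C0 s0 st C0v.
have sB : [set x | s < v x] `<=` B.
  move=> x /= sv; case: C0v => _ _; apply; apply: subset_closure => /=.
  by rewrite gt_eqF// (lt_trans s0).
have Og : FO B (excess t v).
  apply: (dom_on_C0 hE) => //; case: C0g => cg kg sg; split=> //.
  exact: subset_trans sB.
have -> : \int[mu]_(x in [set x | s < v x]) excess t v x =
    \int[mu]_(x in B) excess t v x.
  rewrite Rintegral_mkcond [RHS]Rintegral_mkcond; apply: eq_Rintegral => x _.
  rewrite !patchE; have [xs|] := boolP (x \in [set x | s < v x]).
    by rewrite mem_set//; apply: sB; rewrite inE in xs.
  rewrite notin_setE /= => /negP; rewrite -leNgt => vs.
  by case: ifP => // _; rewrite /excess max_r//; lra.
rewrite -uphi//.
have Fu := dom_on_F Ou.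
have := E_amgm hE ltr01 (F_B hE Fv Fu) Fg.
by rewrite (E_Bl hE)// invr1; lra.
Qed.

(** Let v in F and C_0(B) be so close to u that {|u - v| >= h} has measure at
    most half of mu {u >= t + 4 h}.  Then D = {v > t + h} has measure at most
    2 mu {u >= t}, and G = {v >= t + 3 h} at least mu {u >= t + 4 h} / 2.  For
    g = (v - t - 2 h)_+, Faber-Krahn on D and the energy bound give,
    up to a small error, |g|_2^2 <= C mu(D) / lambda_1(D)^2, while g >= h on G. *)
Lemma level_decay t h : 0 < t -> 0 < h ->
  h ^+ 2 * m (t + 4 * h) <=
    32 * Lam^-1 ^+ 2 * m t * (2 * m t / fine (mu B)) `^ (2 * nu).
Proof.
move=> t0 h0; have h20 : 0 < h ^+ 2 by rewrite exprn_gt0.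
have mt0 s : 0 <= m s by exact: fine_ge0.
have lvlB s : level s `<=` B by move=> x [].
have [m40|] := eqVneq (m (t + 4 * h)) 0.
  rewrite m40 mulr0; apply: mulr_ge0; last exact: powR_ge0.
  by apply: mulr_ge0 => //; apply: mulr_ge0 => //; exact: sqr_ge0.
move=> mN0; have m4 : 0 < m (t + 4 * h) by rewrite lt_neqAle eq_sym mN0 mt0.
have m4t : m (t + 4 * h) <= m t.
  by apply: fine_le => //; try exact: mge; move=> x [Bx /= ux]; split => //=; lra.
have mBt : m t <= fine (mu B) by apply: fine_le => //; exact: mge.
(* The first bound on e controls {|u - v| >= h}, the second one the error
   2 e / lambda_1(D) made by testing with v in place of u. *)
pose e := Num.min (h ^+ 2 * m (t + 4 * h) / 2) (Lam * h ^+ 2 * m (t + 4 * h) / 8).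
have e0 : 0 < e by rewrite lt_min !divr_gt0// !mulr_gt0.
have [v [Fv C0v] uve] := Ou.2 e e0.
have Fu := dom_on_F Ou; have Fuv := F_B hE Fu Fv.
have mv : measurable_fun setT v := F_measurable hE Fv.
have sq_e : sqnorm2 mu (u - v) <= e.
  by apply: ltW; apply: le_lt_trans uve; exact: (sqnorm2_le_E1 hE).
have Euv_e : E (v - u) (v - u) <= e.
  rewrite (E_sqrB hE)// (E_sym hE Fv Fu).
  have := E_sqrB hE Fu Fv; have := E_le_E1 (mu := mu) (E := E) (u - v); lra.
have e1 : e <= h ^+ 2 * m (t + 4 * h) / 2 by rewrite ge_min lexx.
have e2 : e <= Lam * h ^+ 2 * m (t + 4 * h) / 8 by rewrite ge_min lexx orbT.
pose A := B `&` [set x | h <= `|(u - v) x|].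
have mA : measurable A.
  apply: mge; exact: (measurableT_comp (@normr_measurable R setT) (F_measurable hE Fuv)).
have AB : A `<=` B by move=> x [].
have muA : fine (mu A) <= m (t + 4 * h) / 2.
  rewrite -(ler_pM2l h20) mulrA.
  rewrite -lee_fin EFinM fineK_sub//.
  apply: (@le_trans _ _ (sqnorm2 mu (u - v))%:E).
    apply: sqnorm2_chebyshev => //; [exact: (F_L2 hE)|exact: ltW|].
    by move=> x [].
  by rewrite lee_fin; exact: le_trans e1.
pose D := [set x | t + h < v x].
have oD : open D.
  apply: (@open_comp _ _ v [set y | t + h < y]); last exact: open_gt.
  by case: C0v => cv _ _ x _; exact: cv.
have mD : measurable D by exact: (open_measurable_borel hM).
have DB : D `<=` B.
  move=> x; rewrite /D /= => sv; case: C0v => _ _; apply; apply: subset_closure => /=.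
  by rewrite gt_eqF//; lra.
have muU A1 A2 A3 : measurable A1 -> measurable A2 -> measurable A3 ->
    A2 `<=` B -> A3 `<=` B -> A1 `<=` A2 `|` A3 ->
    fine (mu A1) <= fine (mu A2) + fine (mu A3).
  move=> m1 m2 m3 B2 B3 A123.
  have A1B : A1 `<=` B by move=> x /A123[/B2|/B3].
  rewrite -lee_fin EFinD !fineK_sub//.
  apply: (@le_trans _ _ (mu (A2 `|` A3))).
    by rewrite le_measure ?inE//; exact: measurableU.
  exact: measureU2.
have muD : fine (mu D) <= 2 * m t.
  have : fine (mu D) <= m t + fine (mu A).
    apply: muU => //; first exact: mge.
    move=> x /= Dx; have Bx := DB x Dx.
    have [ut|ut] := leP t (u x); [by left|right; split => //=].
    by rewrite !fctE distrC ler_normr; apply/orP; left; move: Dx; rewrite /D /=; lra.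
  lra.
pose G := B `&` [set x | t + 3 * h <= v x].
have mG : measurable G by exact: mge.
have GB : G `<=` B by move=> x [].
have muG : m (t + 4 * h) / 2 <= fine (mu G).
  have : m (t + 4 * h) <= fine (mu G) + fine (mu A).
    apply: muU => //; first exact: mge.
    move=> x [Bx /= ux].
    have [vt|vt] := leP (t + 3 * h) (v x); [by left|right; split => //=].
    by rewrite !fctE ler_normr; apply/orP; left; lra.
  lra.
have GD : G `<=` D by move=> x [_]; rewrite /D /=; lra.
have muD0 : 0 < fine (mu D).
  by apply: lt_le_trans (fine_le mG mD GD DB); apply: lt_le_trans muG; lra.
have DN0 : D !=set0.
  by apply/set0P/eqP => D0; move: muD0; rewrite D0 measure0 ltxx.
have FKD := faber_krahn oD DN0 DB.
pose LD := Lam * (fine (mu B) / fine (mu D)) `^ nu.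
have LD0 : 0 < LD by apply: mulr_gt0 => //; apply: powR_gt0; exact: divr_gt0.
pose g := excess (t + 2 * h) v.
have th0 : 0 < t + h by lra.
have thh : t + h < t + 2 * h by lra.
have Fg : F g by apply: (excess_E hE hreg _ Fv C0v).1; lra.
have Og : FO D g by apply: (dom_on_C0 hE) => //; exact: excess_C0 C0v.
have sqg : LD * sqnorm2 mu g <= E g g := poincare_of_lambda1 FKD Og.
have := excess_energy th0 thh Fv C0v; rewrite -/D -/g => Eg.
have LD20 : 0 < LD / 2 by rewrite divr_gt0.
have muDy : (mu D < +oo)%E.
  by apply: le_lt_trans muB; rewrite le_measure ?inE.
have := Rintegral_le_sqnorm2 (F_L2 hE Fg) mD muDy LD20.
have -> : 2 * (LD / 2) = LD by field.
move=> ig.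
have cheb : h ^+ 2 * fine (mu G) <= sqnorm2 mu g.
  rewrite -lee_fin EFinM fineK_sub//.
  apply: sqnorm2_chebyshev => //; [exact: (F_L2 hE)|exact: ltW|].
  move=> x [_ /= vx]; rewrite /g /excess ler_normr; apply/orP; left.
  by rewrite le_max; apply/orP; left; lra.
have sg : sqnorm2 mu g <= 2 * e / LD + 4 * fine (mu D) / LD ^+ 2.
  have -> : 2 * e / LD + 4 * fine (mu D) / LD ^+ 2 =
      (2 * e + 4 * (LD^-1 * fine (mu D))) / LD by field; rewrite gt_eqF.
  rewrite ler_pdivlMr// mulrC.
  set I := \int[mu]_(x in D) _ in ig Eg; set S := sqnorm2 _ g in sqg ig *.
  set T := LD^-1 * _ in ig *; nra.
have LDinv : LD^-1 = Lam^-1 * (fine (mu D) / fine (mu B)) `^ nu.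
  rewrite /LD invfM; congr (_ * _).
  have -> : fine (mu B) / fine (mu D) = (fine (mu D) / fine (mu B)) `^ (- 1).
    by rewrite powR_inv1 ?invf_div// divr_ge0// ltW.
  by rewrite -powRrM mulN1r powRN invrK.
have r1 : fine (mu D) / fine (mu B) <= 1 by rewrite ler_pdivrMr// mul1r fine_le.
have r0 : 0 <= fine (mu D) / fine (mu B) by rewrite divr_ge0 ?ltW.
have LD1 : LD^-1 <= Lam^-1.
  rewrite LDinv; apply: ler_piMr; first by rewrite invr_ge0 ltW.
  apply: (@le_trans _ _ (1 `^ nu)); last by rewrite powR1.
  by apply: ge0_ler_powR; rewrite ?nnegrE// ltW.
have eLD : 2 * e / LD <= h ^+ 2 * m (t + 4 * h) / 4.
  apply: (@le_trans _ _ (2 * e / Lam)).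
    by rewrite ler_wpM2l// mulr_ge0// ltW.
  by rewrite ler_pdivrMr//; move: e2; lra.
have pD : 4 * fine (mu D) / LD ^+ 2 <=
    8 * (Lam^-1 ^+ 2) * m t * (2 * m t / fine (mu B)) `^ (2 * nu).
  rewrite -exprVn LDinv exprMn.
  have -> : ((fine (mu D) / fine (mu B)) `^ nu) ^+ 2 =
      (fine (mu D) / fine (mu B)) `^ (2 * nu).
    by rewrite [2 * nu]mulrC powRrM powR_mulrn ?powR_ge0.
  have : (fine (mu D) / fine (mu B)) `^ (2 * nu) <=
      (2 * m t / fine (mu B)) `^ (2 * nu).
    apply: ge0_ler_powR; rewrite ?nnegrE ?mulr_ge0 ?invr_ge0 ?(ltW nu0) ?(ltW fine_muB0) ?(ltW muD0)//.
    by rewrite ler_wpM2r// invr_ge0 ltW.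
  have := powR_ge0 (fine (mu D) / fine (mu B)) (2 * nu).
  have : 0 <= Lam^-1 ^+ 2 by exact: sqr_ge0.
  set X := _ `^ _; set Y := _ `^ _; set Z := Lam^-1 ^+ 2 => Z0 X0 XY.
  rewrite (_ : 4 * fine (mu D) * (Z * X) = (4 * Z) * (fine (mu D) * X)); last by ring.
  rewrite (_ : 8 * Z * m t * Y = (4 * Z) * (2 * m t * Y)); last by ring.
  apply: ler_wpM2l; first by rewrite mulr_ge0.
  by apply: ler_pM => //; exact: ltW.
move: pD; set Z := 8 * _ * _ * _.
rewrite (_ : 32 * _ * _ * _ = 4 * Z); last by rewrite /Z; ring.
have : h ^+ 2 * (m (t + 4 * h) / 2) <= h ^+ 2 * fine (mu G) by rewrite ler_pM2l.
lra.
Qed.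

(** Chosen at least 1, so that its square dominates the constant required by
    [de_giorgi_iteration] without extracting a square root. *)
Definition torsion_constant (n : R) : R := 32 * 2 `^ (2 * n) * 2 `^ (n^-1) + 1.

Lemma torsion_le : \forall x \ae mu, u x <= 9 * (torsion_constant nu / Lam).
Proof.
pose K := 32 * Lam^-1 ^+ 2 * 2 `^ (2 * nu).
pose L := torsion_constant nu / Lam.
have c1 : 1 <= torsion_constant nu by rewrite lerDr !mulr_ge0// powR_ge0.
have L0 : 0 < L by rewrite divr_gt0// (lt_le_trans ltr01).
pose a t := m t / fine (mu B).
have mt0 s : 0 <= m s by exact: fine_ge0.
have a01 t : 0 <= a t <= 1.
  rewrite /a; apply/andP; split; first by rewrite divr_ge0// ltW.
  rewrite ler_pdivrMr// mul1r; apply: fine_le => //; first exact: mge.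
  by move=> x [].
have : a (9 * L) = 0.
  apply: (@de_giorgi_iteration _ a K nu L) => //.
  - move=> t h t0 h0; rewrite /a mulrA ler_pdivrMr//.
    apply: (le_trans (level_decay t0 h0)).
    have mb0 : 0 <= m t / fine (mu B) by rewrite divr_ge0// ltW.
    rewrite -(mulrA 2) (powRM (2 * nu) _ mb0)// /K.
    rewrite le_eqVlt; apply/orP; left; apply/eqP.
    by field; rewrite gt_eqF// gt_eqF.
  - apply: mulr_ge0; last exact: powR_ge0.
    by apply: mulr_ge0 => //; exact: sqr_ge0.
  - rewrite powRN /K /L /torsion_constant.
    set X := 2 `^ (2 * nu); set Y := 2 `^ nu^-1.
    have Y0 : 0 < Y by rewrite powR_gt0.
    have X0 : 0 <= X by exact: powR_ge0.
    rewrite ler_pdivlMl// exprMn mulrC.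
    rewrite (_ : 32 * _ * _ * _ = (32 * X * Y) * Lam^-1 ^+ 2); last by ring.
    rewrite ler_wpM2r ?sqr_ge0//.
    have : 0 <= X * Y by rewrite mulr_ge0// ltW.
    nra.
  - move=> s t st; rewrite /a; apply: ler_wpM2r; first by rewrite invr_ge0 ltW.
    apply: fine_le; try exact: mge; last by move=> x [].
    by move=> x [Bx /= tx]; split=> //=; exact: le_trans tx.
move=> /eqP; rewrite /a mulf_eq0 invr_eq0 (gt_eqF fine_muB0) orbF => /eqP m0.
have mu0 : mu (level (9 * L)) = 0%E.
  by rewrite -fineK_sub ?[fine _]m0//; [exact: mge|move=> x []].
have := dom_on_vanish hE mB Ou.
have : \forall x \ae mu, ~ level (9 * L) x.
  exists (level (9 * L)); split => //; first exact: mge.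
  by move=> x /= /contrapT.
apply: filterS2 => x nl Bx; rewrite leNgt; apply/negP => ux.
have [xB|xB] := pselect (B x).
  by apply: nl; split=> //=; exact: ltW.
by move: ux; rewrite Bx//= ltNge mulr_ge0// ltW.
Qed.

End torsion_bound.

(** * Sublevel sets of the torsion function *)

Section cutoff_functions.
Context {d : measure_display} {R : realType} {M : metricMeasurableType d R}.
Context {mu : {measure set M -> \bar R}}.
Context {F : set (M -> R)} {E : (M -> R) -> (M -> R) -> R}.
Context (hballs : @balls_precompact d R M).
Context (hE : dirichlet_form mu F E) (hreg : regular_form mu F E).

Local Notation FO := (dom_on mu F E).

Lemma minr_contraction (a b c : R) :
  `|Num.min (Num.max a 0) c - Num.min (Num.max b 0) c| <= `|a - b|.
Proof.
apply: le_trans (maxr0_contraction a b).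
move: (Num.max a 0) (Num.max b 0) => s t.
have := ler_norm (s - t); have := ler_norm (t - s); rewrite (distrC t).
move: `|s - t| => e ts st; rewrite ler_norml.
by case: (lerP s c); case: (lerP t c) => ? ?; apply/andP; split; lra.
Qed.

(** A cutoff function vanishes outside a smaller ball but is only known to be in
    F.  If psi in F and C_0 of the large ball is at least 1 on the smaller one,
    then phi = min (phi_+, psi), and the functions min (v_+, psi), for v in F
    and C_0 close to phi, approximate it in L^2 with bounded energy. *)
Lemma cutoff_dom_on (x : M) (r : R) U phi : 0 < r ->
  cutoff mu F U (ball x (r / 2)) phi -> FO (ball x r) phi.
Proof.
move=> r0 [Fphi _ phi0 phi01].
have [psi [Fpsi C0psi psi0 psi1]] := bump_exists hballs hE hreg x r0.
pose C := 6 * E psi psi + 4 * (E phi phi + 1).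
suff [] : FO (ball x r) phi /\ E phi phi <= C by [].
apply: (dom_on_weak_closure hE); first exact: (F_L2 hE).
move=> e e0; have [e' e'0 He'] := E_upper_semicontinuous hE Fphi ltr01.
have [|v [Fv C0v]] := hreg.1 phi (Num.min e e') Fphi.
  by rewrite lt_min e0.
rewrite lt_min => /andP[ve ve'].
have [Fvp Evp] := F_pos hE hreg Fv.
have Ev : E v v <= E phi phi + 1.
  by apply: He' => //; apply: le_lt_trans ve'; exact: E_le_E1.
have Fd := F_B hE Fpsi Fvp; have [Fdp Edp] := F_pos hE hreg Fd.
pose q y := Num.min (Num.max (v y) 0) (psi y).
have qE : q = psi - (psi - v^\+)^\+.
  apply/funext => y.
  transitivity (psi y - Num.max (psi y - Num.max (v y) 0) 0); last by [].
  rewrite /q; move: (Num.max (v y) 0) (psi y) => s t.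
  by case: (lerP s t) => st; [rewrite max_l|rewrite max_r]; lra.
have Fq : F q by rewrite qE; exact: (F_B hE).
exists q; split.
- apply: (dom_on_C0 hE) => //; apply: (C0_subsupport C0psi).
    rewrite qE => y; apply: cvgB; first by case: C0psi => c _ _; exact: c.
    apply: (@contraction_continuous _ _ _ (fun t => Num.max t 0) (psi - v^\+)).
      exact: maxr0_contraction.
    move=> z; apply: cvgB; first by case: C0psi => c _ _; exact: c.
    apply: (contraction_continuous maxr0_contraction).
    by case: C0v.
  by move=> y py; rewrite /q py min_r// le_max lexx orbT.
- pose f y := Num.min (Num.max (phi y) 0) (psi y).
  have fphi : phi = f %[ae mu].
    apply: filterS2 phi0 phi01 => y py /andP[py0 py1] _; rewrite /f max_l//.
    have [yB|yB] := pselect (ball x (r / 2) y).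
      by rewrite min_l// (le_trans py1)// psi1.
    by rewrite py// min_l.
  have mphi := F_measurable hE Fphi; have mpsi := F_measurable hE Fpsi.
  have mf : measurable_fun setT f.
    apply: measurable_minr => //; apply: measurable_maxr => //.
  apply: le_lt_trans ve.
  apply: (@le_trans _ _ (sqnorm2 mu (phi - v))); last exact/(sqnorm2_le_E1 hE)/(F_B hE).
  rewrite (@sqnorm2_ae _ _ _ mu (q - phi) (q - f)).
  + apply: sqnorm2_le; first exact: (F_L2 hE (F_B hE Fphi Fv)).
      apply: measurable_funB => //; exact: (F_measurable hE).
    by move=> y; rewrite [leRHS]distrC; exact: minr_contraction.
  + apply: measurable_funB => //; exact: (F_measurable hE).
  + apply: measurable_funB => //; exact: (F_measurable hE).
  + by apply: filterS fphi => y /(_ I) fy _; rewrite !fctE fy.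
- rewrite qE; apply: (le_trans (E_B_le2 hE Fpsi Fdp)).
  have := E_B_le2 hE Fpsi Fvp; rewrite /C; lra.
Qed.

End cutoff_functions.

Section torsion_lower_bound.
Context {d : measure_display} {R : realType} {M : metricMeasurableType d R}.
Context {mu : {measure set M -> \bar R}}.
Context {F : set (M -> R)} {E : (M -> R) -> (M -> R) -> R}.
Context (hE : dirichlet_form mu F E) (hreg : regular_form mu F E).

Local Notation FO := (dom_on mu F E).

(** With g = (lam phi - u)_+, E (u, g) = lam E (phi, g) - E (lam phi - u, g) and
    E (lam phi - u, g) >= E (g, g); then complete the square. *)
Lemma torsion_deficit_le (B : set M) u phi (lam : R) : FO B u -> FO B phi ->
  (forall g, FO B g -> E u g = \int[mu]_(x in B) g x) -> 0 < lam ->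
  \int[mu]_(x in B) ((lam *: phi - u)^\+ x) <= lam ^+ 2 / 4 * E phi phi.
Proof.
move=> Ou Ophi uE lam0; have Olp := dom_on_Z hE lam Ophi.
have Ow := dom_on_B hE Olp Ou; have [Og _] := dom_on_pos hE Ow.
have Fphi := dom_on_F Ophi; have Fu := dom_on_F Ou; have Fg := dom_on_F Og.
rewrite -uE//; have := E_pos_le hE hreg (dom_on_F Ow).
move: Og Fg; set g := _^\+ => Og Fg.
rewrite (E_Bl hE (dom_on_F Olp) Fu Fg) (E_Zl hE)//.
have l20 : 0 < lam / 2 by rewrite divr_gt0.
have := E_amgm hE l20 Fphi Fg.
set X := E phi g; set Y := E g g; set Z := E phi phi; set W := E u g => H1 H2.
have : lam / 2 * (2 * X) <= lam / 2 * (lam / 2 * Z + (lam / 2)^-1 * Y).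
  by rewrite ler_pM2l.
rewrite mulrDr (mulrA (lam / 2) _^-1) mulfV ?gt_eqF// mul1r; nra.
Qed.

Lemma torsion_sublevel_le (B A : set M) u phi (lam : R) : measurable B ->
  (mu B < +oo)%E -> measurable A -> A `<=` B ->
  FO B u -> FO B phi ->
  (forall g, FO B g -> E u g = \int[mu]_(x in B) g x) -> 0 < lam ->
  phi = cst 1 %[ae mu in A] ->
  (forall x, A x -> u x <= lam / 2) ->
  fine (mu A) <= lam / 2 * E phi phi.
Proof.
move=> mB muB mA AB Ou Ophi uE lam0 phi1 uA.
have := torsion_deficit_le Ou Ophi uE lam0.
have Ow := dom_on_B hE (dom_on_Z hE lam Ophi) Ou; have [] := dom_on_pos hE Ow.
set g := _^\+ => Og _ H.
have l20 : 0 < lam / 2 by rewrite divr_gt0.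
rewrite -(ler_pM2l l20); apply: (@le_trans _ _ (lam ^+ 2 / 4 * E phi phi)); last first.
  by rewrite le_eqVlt; apply/orP; left; apply/eqP; field.
apply: le_trans H; rewrite -Rintegral_cst//.
have mg : measurable_fun setT (EFin \o g).
  by apply/measurable_EFinP; exact: (F_measurable hE (dom_on_F Og)).
have g0 x : (0 <= (g x)%:E)%E by rewrite lee_fin; exact: funrpos_ge0.
rewrite -lee_fin fineK; last first.
  rewrite integral_cst// fin_numM// ge0_fin_numE//.
  by apply: le_lt_trans muB; rewrite le_measure ?inE.
rewrite fineK; last first.
  by apply: integrable_fin_num => //; exact: (dom_on_integrable hE).
apply: (@le_trans _ _ (\int[mu]_(x in A) (g x)%:E)%E); last first.
  by apply: ge0_subset_integral => //; exact: measurable_funTS.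
apply: ae_ge0_le_integral => //.
- by move=> x _; rewrite lee_fin ltW.
- exact: measurable_funTS.
- apply: filterS phi1 => x p1 Ax; rewrite lee_fin.
  have -> : g x = Num.max (lam * phi x - u x) 0 by [].
  by rewrite p1// mulr1 le_max; apply/orP; left; have := uA x Ax; lra.
Qed.

End torsion_lower_bound.

(** * Comparison of volumes and scales *)

Section volume_and_scale.
Context {d : measure_display} {R : realType} {M : metricMeasurableType d R}.
Context {mu : {measure set M -> \bar R}}.
Context (hM : metric_measure_space mu) (hballs : @balls_precompact d R M).

Lemma VD_ratio (delta : R) : VD mu -> 0 < delta ->
  exists2 K : R, 0 < K & forall (x : M) (r : R), 0 < r ->
    (mu (ball x (r / 2)) <= K%:E * mu (ball x (delta * r)))%E.
Proof.
move=> [C C1 HC] delta0; have C0 : 0 < C by exact: lt_le_trans C1.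
have iterVD k x s : 0 < s ->
    (mu (ball x (2 ^+ k * s)) <= (C ^+ k)%:E * mu (ball x s))%E.
  move=> s0; elim: k => [|k IH]; first by rewrite !expr0 mul1r mul1e.
  rewrite exprS -mulrA; apply: (le_trans (HC _ _ _)); first by rewrite mulr_gt0// exprn_gt0.
  by rewrite exprS EFinM -muleA lee_pmul2l// lte_fin.
have [k _ Hk] := near_infty_natSinv_expn_lt (PosNum delta0).
exists (C ^+ k); first by rewrite exprn_gt0.
move=> x r r0; apply: le_trans (iterVD k x _ (mulr_gt0 delta0 r0)).
apply: le_measure; rewrite ?inE; [exact: (ball_measurable hM)|exact: (ball_measurable hM)|].
apply: le_ball; have := Hk k (leqnn k) => /= /ltW.
rewrite ler_pdivrMr ?exprn_gt0// => H.
have : r <= delta * 2 ^+ k * r by rewrite ler_peMl// ltW.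
by rewrite (mulrC delta) -mulrA; lra.
Qed.

Lemma scale_gt0 (w : M -> R -> R) x r : scale_function w -> 0 < r -> 0 < w x r.
Proof.
move=> [_ wmono w0 _] r0; rewrite -(w0 x); apply: wmono => //.
  by rewrite in_itv/= lexx.
by rewrite in_itv/= ltW.
Qed.

Lemma scale_doubling (w : M -> R -> R) : scale_function w ->
  exists2 K : R, 0 < K & forall x r, 0 < r -> w x r <= K * w x (r / 2).
Proof.
move=> hw; have [_ _ _ [C1 [C2 [b1 [b2 [C10 C20 b10 b12 H]]]]]] := hw.
exists (C2 * 2 `^ b2); first by rewrite mulr_gt0// powR_gt0.
move=> x r r0; have r20 : 0 < r / 2 by rewrite divr_gt0.
have rr : r / 2 <= r by lra.
have := H x x (r / 2) r r20 rr; rewrite mdistxx ltW// => /(_ isT)/andP[_].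
rewrite ler_pdivrMr ?scale_gt0//.
by rewrite invf_div mulrCA divff ?gt_eqF// mulr1.
Qed.

End volume_and_scale.

(** * The two estimates *)

Section torsion_estimates.
Context {d : measure_display} {R : realType} {M : metricMeasurableType d R}.
Context {mu : {measure set M -> \bar R}} {Rbar : \bar R} {w : M -> R -> R}.
Context {F : set (M -> R)} {E : (M -> R) -> (M -> R) -> R} {J : R.-ker M ~> M}.
Context (hM : metric_measure_space mu) (hballs : @balls_precompact d R M).
Context (hw : scale_function w).
Context (hE : dirichlet_form mu F E) (hreg : regular_form mu F E).
Context (hFK : FK mu F E w Rbar).

Local Notation FO := (dom_on mu F E).

Lemma torsion_on_balls : exists C sigma : R, [/\ 0 < C, 0 < sigma < 1 &
  forall (x : M) (r : R), 0 < r -> (r%:E < sigma%:E * Rbar)%E ->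
  exists u, [/\ the_weak_solution mu F E (ball x r) u, FO (ball x r) u,
    forall y, 0 <= u y,
    forall phi, FO (ball x r) phi -> E u phi = \int[mu]_(y in ball x r) phi y &
    \forall y \ae mu, u y <= C * w x r]].
Proof.
have [CF [nu [sigma [CF0 nu0 sigma01 HFK]]]] := hFK.
have T0 : 0 < torsion_constant nu.
  by rewrite ltr_wpDl// !mulr_ge0// powR_ge0.
exists (9 * (torsion_constant nu * CF)), sigma; split=> //.
  by rewrite !mulr_gt0.
move=> x r r0 rs; have w0 : 0 < w x r := scale_gt0 x hw r0.
have Lam0 : 0 < CF^-1 / w x r by rewrite divr_gt0 ?invr_gt0.
have HB D := HFK x r D r0 rs.
have oB := metric_ball_open x r.
have muB := ball_lty hM hballs x r0; have muB0 := ball_gt0 hM x r0.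
have mB := ball_measurable hM x r.
have poin u := poincare_on_ball hE oB muB muB0 HB (u := u).
have [u [ws Ou u0 uphi]] := torsion_function_exists hE hreg mB muB Lam0 poin.
exists u; split=> //.
apply: filterS (torsion_le hM hE hreg oB muB muB0 Lam0 nu0 HB Ou uphi) => y uy.
rewrite (le_trans uy)// le_eqVlt; apply/orP; left; apply/eqP.
by field; rewrite !gt_eqF.
Qed.

Lemma E_le_of_FK : E_le mu F E w Rbar.
Proof.
have [C [sigma [C0 s01 H]]] := torsion_on_balls.
exists C, sigma; split=> // x r r0 rs.
have [u [ws Ou u0 uphi uC]] := H x r r0 rs; exists u => //.
rewrite unlock; case: ifPn => _; last first.
  by rewrite lee_fin mulr_ge0 ?ltW// scale_gt0.
apply/ess_supP; apply: filterS uC => y uy.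
by rewrite /= ger0_norm// lee_fin.
Qed.

Context (hRbar : admissible_radius (M := M) Rbar).
Context (hVD : VD mu) (hCap : Cap_le mu F E w Rbar).

(** The capacity condition is used on the ball of radius r / 2, whose cutoff
    functions belong to F(ball r); doubling converts the bound to the scale r
    and to the volume of the small ball of radius delta * r. *)
Lemma cutoff_energy (delta : R) : 0 < delta ->
  exists2 Q : R, 0 < Q & forall (x : M) (r : R), 0 < r -> (r%:E < Rbar)%E ->
  exists phi, [/\ FO (ball x r) phi, phi = cst 1 %[ae mu in ball x (r / 3)] &
    E phi phi <= Q / w x r * fine (mu (ball x (delta * r)))].
Proof.
move=> delta0; have [K K0 HK] := VD_ratio hM hVD delta0.
have [K' K'0 HK'] := scale_doubling hw; have [C C0 HC] := hCap.
exists (2 * C * K' * K); first by rewrite !mulr_gt0.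
move=> x r r0 rR; have r20 : 0 < r / 2 by rewrite divr_gt0.
have dr0 : 0 < delta * r by rewrite mulr_gt0.
have r2R : ((r / 2)%:E < Rbar)%E.
  by apply: le_lt_trans rR; rewrite lee_fin; lra.
have := HC x (r / 2) r20 r2R; rewrite -(ball_fineK hM hballs x r20) -EFinM.
set m2 := fine _; have m20 : 0 < m2 by exact: (ball_fine_gt0 hM hballs).
have w2 := scale_gt0 x hw r20; have w1 := scale_gt0 x hw r0.
have X0 : 0 < C / w x (r / 2) * m2 by rewrite mulr_gt0// divr_gt0.
move=> capX.
have : (cap mu F E (ball x (2 / 3 * (r / 2))) (ball x (r / 2)) <
    (2 * (C / w x (r / 2) * m2))%:E)%E.
  by apply: le_lt_trans capX _; rewrite lte_fin; lra.
move=> /ereal_inf_lt [_ [phi cphi <-]]; rewrite lte_fin => Ephi.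
exists phi; split.
- exact: (cutoff_dom_on hballs hE hreg r0 cphi).
- case: cphi => _ + _ _; rewrite (_ : 2 / 3 * (r / 2) = r / 3)//; lra.
- apply: (le_trans (ltW Ephi)).
  have mm : m2 <= K * fine (mu (ball x (delta * r))).
    rewrite -lee_fin EFinM !(ball_fineK hM hballs)//; exact: HK.
  have ww : (w x (r / 2))^-1 <= K' / w x r.
    by rewrite ler_pdivlMr// mulrC ler_pdivrMr//; exact: HK'.
  rewrite (_ : 2 * C * K' * K / w x r * _ =
    2 * C * (K' / w x r) * (K * fine (mu (ball x (delta * r))))); last by ring.
  rewrite (_ : 2 * (C / w x (r / 2) * m2) = 2 * C * (w x (r / 2))^-1 * m2); last by ring.
  apply: ler_pM => //; last by apply: ler_wpM2l => //; rewrite mulr_ge0// ltW.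
    by rewrite !mulr_ge0 ?invr_ge0 ?ltW.
  exact: ltW.
Qed.

(** The level lam / 2 is chosen with lam = w / Q, so that the bound
    lam / 2 * E (phi, phi) for the sublevel set is half of the volume of the
    small ball. *)
Lemma torsion_half_ball (delta : R) : 0 < delta -> delta <= 1 / 3 ->
  exists2 c : R, 0 < c & forall (x : M) (r : R) u, 0 < r -> (r%:E < Rbar)%E ->
  FO (ball x r) u ->
  (forall phi, FO (ball x r) phi -> E u phi = \int[mu]_(y in ball x r) phi y) ->
  fine (mu (ball x (delta * r))) / 2 <=
    fine (mu (ball x (delta * r) `&` [set y | c * w x r <= u y])).
Proof.
move=> delta0 delta3; have [Q Q0 HQ] := cutoff_energy delta0.
exists ((2 * Q)^-1); first by rewrite invr_gt0 mulr_gt0.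
move=> x r u r0 rR Ou uE; have [phi [Ophi phi1 Ephi]] := HQ x r r0 rR.
have w0 := scale_gt0 x hw r0; have dr0 : 0 < delta * r by rewrite mulr_gt0.
set b := ball x (delta * r) in Ephi *.
have mb : measurable b := ball_measurable hM x _.
have mub : (mu b < +oo)%E := ball_lty hM hballs x dr0.
pose lam := w x r / Q; have lam0 : 0 < lam by rewrite divr_gt0.
have lE : (2 * Q)^-1 * w x r = lam / 2.
  by rewrite /lam; field; rewrite gt_eqF.
have mu_ : measurable_fun setT u := F_measurable hE (dom_on_F Ou).
have mG : measurable (b `&` [set y | lam / 2 <= u y]).
  by apply: measurableI => //; exact: superlevel_measurable.
pose A := b `\` (b `&` [set y | lam / 2 <= u y]).
have mA : measurable A by exact: measurableD.
have Ab : A `<=` b by move=> y [].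
have muA : fine (mu A) <= lam / 2 * E phi phi.
  apply: (torsion_sublevel_le hE hreg (ball_measurable hM x r)
    (ball_lty hM hballs x r0) mA _ Ou Ophi uE lam0).
  - apply: subset_trans Ab _; apply: le_ball; nra.
  - apply: filterS phi1 => y + Ay; apply; have := Ab y Ay.
    by apply: le_ball; nra.
  - move=> y [by_ /=]; have [//|] := lerP (u y) (lam / 2).
    by move=> uy nby; exfalso; apply: nby; split=> //=; exact: ltW.
have bE : fine (mu b) = fine (mu A) + fine (mu (b `&` [set y | lam / 2 <= u y])).
  have Gy : (mu (b `&` [set y | (lam / 2 <= u y)%R]) < +oo)%E.
    by apply: le_lt_trans mub; rewrite le_measure ?inE//; move=> y [].
  have Ay : (mu A < +oo)%E.
    by apply: le_lt_trans mub; rewrite le_measure ?inE.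
  rewrite -fineD ?ge0_fin_numE// -measureU//.
    congr (fine (mu _)); apply/seteqP; split=> y.
      have [uy|uy] := pselect (lam / 2 <= u y).
        by move=> yb; right.
      by move=> yb; left; split=> // -[].
    by case=> [/Ab|[]].
  by apply/seteqP; split=> y // [[_ H] /H].
rewrite lE bE.
suff : fine (mu A) <= fine (mu b) / 2 by rewrite bE; lra.
apply: (le_trans muA).
have -> : fine (mu b) / 2 = lam / 2 * (Q / w x r * fine (mu b)).
  by rewrite /lam; field; rewrite !gt_eqF.
by rewrite ler_pM2l// divr_gt0.
Qed.

Lemma Lnorm_zero_fun (p : \bar R) : p != 0%E ->
  Lnorm mu p (EFin \o (0 : M -> R)) = 0%E.
Proof. exact: Lnorm0. Qed.

Context (hwEH : wEH mu F E J w Rbar).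

Lemma E_ge_of_wEH : E_ge mu F E w Rbar.
Proof.
have [C [sigma1 [C0 /andP[s10 s11] Htor]]] := torsion_on_balls.
have [p [delta0 [sigma2 [CH [/andP[p0 p1] /andP[d0 d1] /andP[s20 s21] CH1 Hweh]]]]] := hwEH.
have CH0 : 0 < CH by exact: lt_le_trans CH1.
pose delta := Num.min delta0 (1 / 3).
have delta_gt0 : 0 < delta by rewrite lt_min d0 /= divr_gt0.
have delta_le : delta <= delta0 by rewrite ge_min lexx.
have delta3 : delta <= 1 / 3 by rewrite ge_min lexx orbT.
have [c c0 Hc] := torsion_half_ball delta_gt0 delta3.
have Rbar0 : (0 <= Rbar)%E by case/andP: hRbar => /ltW.
exists (CH^-1 * (2^-1 `^ p^-1 * c)), (sigma1 * sigma2), delta; split.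
- by rewrite mulr_gt0 ?invr_gt0// mulr_gt0// powR_gt0.
- by rewrite mulr_gt0//= mulr_ilt1// ltW.
- by rewrite delta_gt0; lra.
move=> x r r0 rs.
have rs1 : (r%:E < sigma1%:E * Rbar)%E.
  apply: (lt_le_trans rs); rewrite lee_wpmul2r// lee_fin.
  by rewrite ler_piMr// ltW.
have rs2 : (r%:E < sigma2%:E * Rbar)%E.
  apply: (lt_le_trans rs); rewrite lee_wpmul2r// lee_fin.
  by rewrite ler_piMl// ltW.
have rR : (r%:E < Rbar)%E.
  apply: (lt_le_trans rs1); rewrite -[leRHS]mul1e lee_wpmul2r// lee_fin.
  exact: ltW.
have w0 := scale_gt0 x hw r0; have dr0 : 0 < delta * r by rewrite mulr_gt0.
have [u [ws Ou u0 uE uC]] := Htor x r r0 rs1; exists u => //.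
have Fu := dom_on_F Ou; have mu_ := F_measurable hE Fu.
have un0 : u^\- = 0 :> (M -> R).
  by apply/funext => y; rewrite /funrneg max_r// oppr_le0.
set b := ball x (delta * r).
have mb : measurable b := ball_measurable hM x _.
have mub0 : 0 < fine (mu b) := ball_fine_gt0 hM hballs x dr0.
(* Although E (u, phi) is the integral of phi, the right-hand side used is 0
   and not 1: with 1, the term w(B_r) |f| would be of the order of the bound
   that is to be proved. *)
have := Hweh x (delta * r) r 0 u dr0 _ rs2.
have f0 : (0 : M -> R) \_ (ball x r) = 0.
  by apply/funext => y; rewrite patchE; case: ifP.
have mid : delta * r <= delta0 * r by rewrite ler_wpM2r// ltW.
have Linf0 : Linfty mu ((0 : M -> R) \_ (ball x r)).
  rewrite f0; apply/andP; split; first by rewrite inE; exact: measurable_cst.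
  rewrite inE; suff : finite_norm mu +oo%E (0 : M -> R) by [].
  by rewrite /finite_norm Lnorm_zero_fun.
have Linfu : Linfty mu u.
  apply/andP; split; rewrite inE//= /finite_norm unlock.
  case: ifPn => // _; apply: (@le_lt_trans _ _ (C * w x r)%:E); last exact: ltry.
  apply/ess_supP; apply: filterS uC => y uy.
  by rewrite /= ger0_norm// lee_fin.
have sup : superharmonic mu F E (ball x r) 0 u.
  exists u => //; exists 0; first by apply/funext => y; rewrite !fctE addr0.
  move=> phi Ophi phi0.
  rewrite integral0_eq; last by move=> y _; rewrite /= mul0r.
  have -> : (E u phi)%:E = (\int[mu]_y (phi y)%:E)%E by exact: ws.1.2.
  have mphi : measurable_fun setT (EFin \o phi).
    by apply/measurable_EFinP; exact: (F_measurable hE (dom_on_F Ophi)).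
  have mphip : measurable_fun setT (EFin \o phi^\+).
    apply/measurable_EFinP; apply: measurable_funrpos.
    exact: (F_measurable hE (dom_on_F Ophi)).
  rewrite (ae_eq_integral (EFin \o phi^\+))//.
    by apply: integral_ge0 => y _; rewrite lee_fin; exact: funrpos_ge0.
  by apply: filterS phi0 => y py _; rewrite /= /funrpos max_l.
have Fp : Fprime F u.
  by exists u => //; exists 0; apply/funext => y; rewrite !fctE addr0.
move=> /(_ mid Linf0 Fp Linfu (aeW mu (fun y _ => u0 y)) sup) {mid Linf0 Fp Linfu sup}.
rewrite un0 f0 Lnorm_zero_fun// adde0.
set T := tail _ _ _ _ _; set I := ess_inf_on _ _ _ => HI.
have T0 : (T <= 0)%E.
  apply/ess_supP; apply: aeW => y; rewrite /patch; case: ifP => _; last exact: leNye.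
  by rewrite integral0_eq// => z _; rewrite normr0.
have HI2 : (((fine (mu b))^-1%:E * \int[mu]_(y in b) (u y `^ p)%:E) `^ p^-1 <=
    CH%:E * I)%E.
  apply: (le_trans HI); rewrite lee_pmul2l//.
  rewrite -[leRHS]adde0 leeD//; apply: mule_ge0_le0 => //.
  by rewrite lee_fin ltW// scale_gt0.
have Hcu := Hc x r u r0 rR Ou uE.
set G := b `&` _ in Hcu.
have mG : measurable G.
  by apply: measurableI => //; exact: superlevel_measurable.
have Gb : G `<=` b by move=> z [].
have cw0 : 0 < c * w x r by rewrite mulr_gt0.
have int_ge : ((fine (mu b) / 2 * (c * w x r) `^ p)%:E <=
    \int[mu]_(y in b) (u y `^ p)%:E)%E.
  have mup : measurable_fun setT (fun y => (u y `^ p)%:E).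
    by apply/measurable_EFinP; apply: (measurableT_comp (measurable_powR _)).
  apply: (@le_trans _ _ (\int[mu]_(y in G) (u y `^ p)%:E)%E); last first.
    apply: ge0_subset_integral => //; first exact: measurable_funTS.
    by move=> z _; rewrite lee_fin powR_ge0.
  apply: (@le_trans _ _ (\int[mu]_(y in G) ((c * w x r) `^ p)%:E)%E); last first.
    apply: ge0_le_integral => //.
    - by move=> z _; rewrite lee_fin powR_ge0.
    - exact: measurable_funTS.
    - move=> z [_ /= uy]; rewrite lee_fin.
      by apply: ge0_ler_powR; rewrite ?nnegrE// ltW.
  rewrite integral_cst// mulrC EFinM lee_wpmul2l ?lee_fin ?powR_ge0//.
  apply: (@le_trans _ _ (fine (mu G))%:E); first by rewrite lee_fin.
  rewrite fineK// ge0_fin_numE//; apply: le_lt_trans (ball_lty hM hballs x dr0).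
  by rewrite le_measure ?inE.
have : ((2^-1 `^ p^-1 * (c * w x r))%:E <= CH%:E * I)%E.
  apply: le_trans HI2.
  have -> : ((2^-1 `^ p^-1 * (c * w x r))%:E =
      ((fine (mu b))^-1%:E * (fine (mu b) / 2 * (c * w x r) `^ p)%:E) `^ p^-1)%E.
    rewrite -EFinM poweR_EFin; congr (_%:E).
    rewrite [_^-1 * _](_ : _ = 2^-1 * (c * w x r) `^ p); last first.
      by field; rewrite gt_eqF.
    rewrite (powRM p^-1 _ (powR_ge0 (c * w x r) p))// -powRrM mulfV ?gt_eqF// powRr1// ltW//.
  have fb0 : (0 <= (fine (mu b))^-1%:E)%E by rewrite lee_fin invr_ge0 ltW.
  have X0 : (0 <= (fine (mu b) / 2 * (c * w x r) `^ p)%:E)%E.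
    by rewrite lee_fin !mulr_ge0 ?powR_ge0// ltW.
  apply: gt0_ler_poweR; first by rewrite invr_ge0 ltW.
  - by rewrite in_itv/= leey andbT mule_ge0.
  - by rewrite in_itv/= leey andbT mule_ge0// (le_trans X0).
  - exact: lee_wpmul2l.
rewrite -lee_pdivrMl// -EFinM; apply: le_trans.
by rewrite lee_fin !mulrA.
Qed.

End torsion_estimates.

Theorem lemma6p3 (d : measure_display) (R : realType)
    (M : metricMeasurableType d R) (mu : {measure set M -> \bar R})
    (Rbar : \bar R) (w : M -> R -> R)
    (F : set (M -> R)) (E : (M -> R) -> (M -> R) -> R) (J : R.-ker M ~> M)
    (hM : metric_measure_space mu)
    (hballs : @balls_precompact d R M)
    (hRbar : @admissible_radius d R M Rbar)
    (hw : scale_function w)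
    (hE : dirichlet_form mu F E)
    (hreg : regular_form mu F E)
    (hBD : no_killing_part mu F E J)
    (hVD : VD mu)
    (hCap : Cap_le mu F E w Rbar)
    (hFK : FK mu F E w Rbar)
    (hwEH : wEH mu F E J w Rbar) :
  E_ge mu F E w Rbar /\ E_le mu F E w Rbar.
Proof.
split.
- exact: (E_ge_of_wEH hM hballs hw hE hreg hFK hRbar hVD hCap hwEH).
- exact: (E_le_of_FK hM hballs hw hE hreg hFK).
Qed.
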